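(* Let $\mathbf{V}$ be a matricially normed space and $u\in\mathbf{V}$ with $\|u\|=1$. Then there exists a matrix order structure on $\mathbf{V}$ turning it into an operator system with order unit $u$ if and only if $n_{\mathrm{cb}}(\mathbf{V};u)=1$ and $\mathbf{K}^1_u$ spans $\mathbf{V}$.
   Context: All vector spaces are complex. $M_{m,n}$ is the space of complex $m\times n$ matrices with the operator norm and $M_n=M_{n,n}$. A matricially normed space $\mathbf{V}$ is a vector space with a norm on each $M_k(\mathbf{V})$ ($k\in\mathbb{N}$) such that $\|\alpha x\beta\|\le\|\alpha\|\|x\|\|\beta\|$ for all $x\in M_m(\mathbf{V})$, $\alpha\in M_{n,m}$, $\beta\in M_{m,n}$. For Hilbert space $H$, $M_k(\mathcal{L}(H))=\mathcal{L}(H^k)$, and $\mathcal{L}(H^k)_+$ is the cone of positive operators. For linear $\varphi:\mathbf{V}\to\mathbf{W}$, $\varphi_k:M_k(\mathbf{V})\to M_k(\mathbf{W})$ denotes entrywise application, $\|\varphi\|_{\mathrm{cb}}=\sup_k\|\varphi_k\|$, and $\mathrm{CB}(\mathbf{V},\mathbf{W})$ is the set of $\varphi$ with $\|\varphi\|_{\mathrm{cb}}<\infty$; $\varphi$ is a complete isometry if every $\varphi_k$ is isometric. For $u\in\mathbf{V}$ with $\|u\|=1$ put $\mathcal{S}_n(\mathbf{V};u)=\{\varphi\in\mathrm{CB}(\mathbf{V},M_n):\|\varphi\|_{\mathrm{cb}}\le1,\ \varphi(u)=I_n\}$, $\gamma^u_k(x)=\sup\{\|\varphi_k(x)\|:\varphi\in\mathcal{S}_n(\mathbf{V};u),\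 n\in\mathbb{N}\}$ for $x\in M_k(\mathbf{V})$, $n_{\mathrm{cb}}(\mathbf{V};u)=\inf\{\gamma^u_k(x):x\in M_k(\mathbf{V}),\ \|x\|=1,\ k\in\mathbb{N}\}$, and $\mathbf{K}^n_u=\{x\in M_n(\mathbf{V}):\varphi_n(x)\ge0\text{ for all }k\in\mathbb{N}\text{ and all }\varphi\in\mathcal{S}_k(\mathbf{V};u)\}$. Operator systems: a matricially normed space $\mathbf{W}$ with cones $\mathbf{W}_n^+\subseteq M_n(\mathbf{W})$ $(n\in\mathbb{N})$ (a matrix order structure) is an operator system with order unit $e\in\mathbf{W}$ if there are a Hilbert space $K$ and a complete isometry $\Phi:\mathbf{W}\to\mathcal{L}(K)$ such that $\Phi(\mathbf{W})$ is self-adjoint, $\Phi(e)=\mathrm{id}_K$ and $\Phi_n(\mathbf{W}_n^+)=\Phi_n(M_n(\mathbf{W}))\cap\mathcal{L}(K^n)_+$ for all $n$ (the involution on $\mathbf{W}$ being the one transported by $\Phi$). *)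

(* Defs.v *)
From HB Require Import structures.
From mathcomp Require Import all_boot all_order all_algebra.
From mathcomp Require Import complex.
From mathcomp Require Import all_classical all_reals all_analysis.

Set Implicit Arguments.
Unset Strict Implicit.
Unset Printing Implicit Defensive.

Import Order.TTheory GRing.Theory Num.Theory.
Import numFieldNormedType.Exports.

Local Open Scope classical_set_scope.
Local Open Scope complex_scope.
Local Open Scope ring_scope.

(* The complex numbers are R[i] for R : realType.  The library norm `|z| of
   z : R[i], or of a vector over R[i], lies in R[i]: complex.Re turns it into a
   real number.  Sizes range over 1, 2, ... and are written k.+1, so that the
   index k of mxnorm, amplnorm and pos_cone stands for the size k.+1 (ampl,
   gamma, mxstates and Kcone take the size itself).  A vector space V is
   identified with 'M[V]_1 through const_mx. *)

Section OperatorNorm.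
Variable R : realType.

Definition l2norm (E : normedZmodType R[i]) n (xi : 'cV[E]_n) : R :=
  Num.sqrt (\sum_(i < n) complex.Re `|xi i 0| ^+ 2).

Definition opnorm (E F : normedZmodType R[i]) m n
    (f : 'cV[E]_n -> 'cV[F]_m) : \bar R :=
  ereal_sup [set (l2norm (f xi))%:E | xi in [set xi | l2norm xi <= 1]].

Definition mx_opnorm m n (A : 'M[R[i]]_(m, n)) : \bar R :=
  opnorm (fun xi : 'cV[R[i]]_n => A *m xi).

Definition mx_pos n : set 'M[R[i]]_n :=
  [set A | forall xi : 'cV[R[i]]_n,
     0 <= \sum_(i < n) (A *m xi) i 0 * (xi i 0)^*%R].

End OperatorNorm.

(* The entrywise action of scalar matrices on M_m(V); the library product *m
   requires the entries of both factors to lie in the same ring. *)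
Definition mx_bimul (K : nzRingType) (V : lmodType K) m n p q
    (a : 'M[K]_(m, n)) (x : 'M[V]_(n, p)) (b : 'M[K]_(p, q)) : 'M[V]_(m, q) :=
  \matrix_(i, j) \sum_(k < n) \sum_(l < p) (a i k * b l j) *: x k l.

HB.mixin Record Lmodule_isMatNormed (R : realType) V
    of GRing.Lmodule R[i] V := {
  mxnorm : forall k, 'M[V]_k.+1 -> R;
  mxnorm_eq0 : forall k (x : 'M[V]_k.+1), mxnorm _ x = 0 -> x = 0;
  mxnormD : forall k (x y : 'M[V]_k.+1), mxnorm _ (x + y) <= mxnorm _ x + mxnorm _ y;
  mxnormZ : forall k (a : R[i]) (x : 'M[V]_k.+1),
    mxnorm _ (map_mx ( *:%R a) x) = complex.Re `|a| * mxnorm _ x;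
  mxnorm_bimul : forall m n
      (a : 'M[R[i]]_(n.+1, m.+1)) (x : 'M[V]_m.+1) (b : 'M[R[i]]_(m.+1, n.+1)),
    ((mxnorm _ (mx_bimul a x b))%:E <=
       mx_opnorm a * (mxnorm _ x)%:E * mx_opnorm b)%E
}.

#[short(type="matNormedType")]
HB.structure Definition MatNormed (R : realType) :=
  { V of GRing.Lmodule R[i] V & Lmodule_isMatNormed R V }.

Arguments mxnorm {R s k} x : rename.

Section NumericalIndex.
Variables (R : realType) (V : matNormedType R).

Definition vnorm (v : V) : R := mxnorm (const_mx v : 'M[V]_1).

(* M_k(M_n) is identified with the complex matrices of size k * n (as a sum of
   k copies of n) by forming block matrices. *)
Definition ampl n (phi : V -> 'M[R[i]]_n) k (x : 'M[V]_k) :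
    'M[R[i]]_(\sum_(i < k) n) :=
  \mxblock_(i < k, j < k) phi (x i j).

Definition amplnorm n (phi : V -> 'M[R[i]]_n) (k : nat) : \bar R :=
  ereal_sup [set mx_opnorm (ampl phi x)
            | x in [set x : 'M[V]_k.+1 | mxnorm x <= 1]].

Definition cbnorm n (phi : V -> 'M[R[i]]_n) : \bar R :=
  ereal_sup (range (amplnorm phi)).

Definition CB n : set {linear V -> 'M[R[i]]_n} :=
  [set phi | (cbnorm phi < +oo)%E].

Definition mxstates (u : V) n : set {linear V -> 'M[R[i]]_n} :=
  [set phi | [/\ CB phi, (cbnorm phi <= 1)%E & phi u = 1%:M]].

Definition gamma (u : V) k (x : 'M[V]_k) : \bar R :=
  ereal_sup [set y | exists n, exists2 phi : {linear V -> 'M[R[i]]_n.+1},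
    mxstates u phi & y = mx_opnorm (ampl phi x)].

Definition ncb (u : V) : \bar R :=
  ereal_inf [set y | exists k, exists2 x : 'M[V]_k.+1,
    mxnorm x = 1 & y = gamma u x].

Definition Kcone (u : V) n : set 'M[V]_n :=
  [set x | forall k (phi : {linear V -> 'M[R[i]]_k.+1}),
    mxstates u phi -> mx_pos (ampl phi x)].

Definition spans (A : set V) : Prop :=
  forall x, exists n (a : 'I_n -> R[i]) (v : 'I_n -> V),
    (forall i, A (v i)) /\ x = \sum_(i < n) a i *: v i.

Definition cone k (C : set 'M[V]_k) : Prop :=
  [/\ C 0, forall x y, C x -> C y -> C (x + y) &
      forall (t : R) x, 0 <= t -> C x -> C (map_mx ( *:%R t%:C) x)].

End NumericalIndex.

(* The form is linear in its first argument and conjugate-linear in the second. *)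
Record hilbertType (R : realType) := HilbertType {
  hilbert_sort :> completeNormedModType R[i];
  hdot : {dot hilbert_sort for Num.conj};
  hdotE : forall x, hdot x x = `|x| ^+ 2
}.

Section OperatorSystem.
Variables (R : realType) (H : hilbertType R).

Definition bounded_op : set (H -> H) :=
  [set T | linear T /\ continuous T].

Definition adjoint_op (T S : H -> H) : Prop :=
  forall x y, hdot H (T x) y = hdot H x (S y).

Definition op_app k (T : 'M[H -> H]_k) (xi : 'cV[H]_k) : 'cV[H]_k :=
  \col_i \sum_(j < k) T i j (xi j 0).

Definition op_pos k : set 'M[H -> H]_k :=
  [set T : 'M[H -> H]_k | (forall i j, bounded_op (T i j)) /\
    forall xi, 0 <= \sum_(i < k) hdot H (op_app T xi i 0) (xi i 0)].

End OperatorSystem.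

Record matrix_order (R : realType) (V : matNormedType R) := MatrixOrder {
  pos_cone :> forall n, set 'M[V]_n.+1;
  pos_coneP : forall n, cone (@pos_cone n)
}.
Arguments pos_cone {R V} C n : rename.

Definition operator_system (R : realType) (V : matNormedType R)
    (C : matrix_order V) (e : V) : Prop :=
  exists (K : hilbertType R) (Phi : {linear V -> (K -> K)}),
    [/\ forall v, bounded_op (Phi v),
        forall k (x : 'M[V]_k.+1),
          opnorm (op_app (map_mx Phi x)) = (mxnorm x)%:E,
        forall v, exists w, adjoint_op (Phi v) (Phi w),
        Phi e = idfun
      & forall n, map_mx Phi @` pos_cone C n =
          range (fun x : 'M[V]_n.+1 => map_mx Phi x) `&` @op_pos R K n.+1].

(* Main.v *)
(* If [V] is represented completely isometrically on [K] with [u] sent to the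
   identity, compressing to the span of a finite orthonormal family gives maps in
   the matrix state spaces; choosing the span to contain a nearly norming vector of
   [x] and its image shows that the matrix states norm [V], so that the index is 1.
   A self-adjoint [v] satisfies ||v + i t u||^2 <= ||v||^2 + t^2 for all real [t],
   which forces the numerical range of [phi v] into the real interval of radius
   ||v|| for each state [phi]; hence ||v|| u + v lies in the cone, and such elements
   together with [u] span [V].
   Conversely, let [K] be the Hilbert direct sum of the C^n over all matrix states
   [phi : V -> M_n] and let [V] act block-diagonally.  Index 1 makes this action
   completely isometric, elements of the cone act as self-adjoint operators, so the
   spanning hypothesis makes the image self-adjoint, and positivity of an operator
   is tested block by block, so that the matrix cones are the ones prescribed. *)
Require Import Defs.
From HB Require Import structures.
From mathcomp Require Import all_boot all_order all_algebra ring lra.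
From mathcomp Require Import complex.
From mathcomp Require Import all_classical all_reals all_analysis.
From mathcomp Require Import finmap.
From mathcomp.analysis.showcase Require Import summability.

Set Implicit Arguments.
Unset Strict Implicit.
Unset Printing Implicit Defensive.

Import Order.TTheory GRing.Theory Num.Theory.
Import numFieldNormedType.Exports.

Local Open Scope classical_set_scope.
Local Open Scope complex_scope.
Local Open Scope ring_scope.

(** * Inner product spaces *)

Section DotTheory.
Variables (C : numClosedFieldType) (U : lmodType C) (f : {dot U for Num.conj}).

Lemma dotDl x y z : f (x + y) z = f x z + f y z.
Proof. by rewrite linearDl. Qed.

Lemma dotZl a x z : f (a *: x) z = a * f x z.
Proof. by rewrite linearZl_LR. Qed.

Lemma dotDr x y z : f x (y + z) = f x y + f x z.
Proof. by rewrite linearDr. Qed.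

Lemma dotZr a x z : f x (a *: z) = a^*%R * f x z.
Proof. by rewrite linearZr_LR. Qed.

Lemma dotC x y : f x y = (f y x)^*%R.
Proof. by rewrite hermC expr0 mul1r. Qed.

Lemma dotBl x y z : f (x - y) z = f x z - f y z.
Proof. by rewrite linearBl. Qed.

Lemma dotBr x y z : f x (y - z) = f x y - f x z.
Proof. by rewrite linearBr. Qed.

Lemma dot0l z : f 0 z = 0.
Proof. by rewrite linear0l. Qed.

Lemma dot0r z : f z 0 = 0.
Proof. by rewrite linear0r. Qed.

Lemma dot_suml I (r : seq I) (P : pred I) F z :
  f (\sum_(i <- r | P i) F i) z = \sum_(i <- r | P i) f (F i) z.
Proof.
by apply: (big_morph (f^~ z)) => [x y|]; rewrite ?dotDl ?dot0l.
Qed.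

Lemma dot_sumr I (r : seq I) (P : pred I) F z :
  f z (\sum_(i <- r | P i) F i) = \sum_(i <- r | P i) f z (F i).
Proof.
by apply: (big_morph (f z)) => [x y|]; rewrite ?dotDr ?dot0r.
Qed.

(** For [v] nonzero, expand the nonnegative value of the form at [u - a *: v], where [a *: v] is the
    orthogonal projection of [u] onto the line of [v]. *)
Lemma dot_CauchySchwarz u v : `|f u v| <= sqrtC (f u u) * sqrtC (f v v).
Proof.
have [->|v0] := eqVneq v 0.
  by rewrite !dot0r normr0 sqrtC0 mulr0.
have fv0 : 0 < f v v by rewrite dnorm_gt0.
rewrite -(@ler_pXn2r _ 2) ?nnegrE ?mulr_ge0 ?sqrt_dnorm_ge0//.
rewrite exprMn !sqrtCK.
set a := f u v / f v v.
have := dnorm_ge0 f (u - a *: v).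
have av : a * f v v = f u v by rewrite divfK ?gt_eqF.
rewrite dotBl !dotBr !dotZl !dotZr mulrCA av opprB addrA subrK.
rewrite (dotC v u) subr_ge0 /a mulrAC -normCK ler_pdivrMr//.
Qed.

(** A crude form of Cauchy-Schwarz: the gap is at least [(a - b)^2 + a * b], with [a] and [b] the
    two norms. It serves to dominate sums of inner products by sums of squares. *)
Lemma dot_norm_le u v : `|f u v| <= f u u + f v v.
Proof.
have s0 := sqrt_dnorm_ge0 f.
apply: (le_trans (dot_CauchySchwarz u v)).
rewrite -[f u u in leRHS]sqrtCK -[f v v in leRHS]sqrtCK.
move: (s0 u) (s0 v); set a := sqrtC _; set b := sqrtC _ => a0 b0.
rewrite -subr_ge0 (_ : _ - _ = (a - b) ^+ 2 + a * b); last by ring.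
apply: addr_ge0; last exact: mulr_ge0.
by apply: real_exprn_even_ge0; rewrite // rpredB ?ger0_real.
Qed.

(** The parallelogram law with the term of [u - v] dropped; it makes square-summable families closed
    under addition. *)
Lemma dot_sqnormD_le u v : f (u + v) (u + v) <= 2 * f u u + 2 * f v v.
Proof.
rewrite -subr_ge0; suff -> : 2 * f u u + 2 * f v v - f (u + v) (u + v) =
  f (u - v) (u - v) by exact: dnorm_ge0.
by rewrite !dotBl !dotBr !dotDl !dotDr; ring.
Qed.

Lemma dot_triangle u v :
  sqrtC (f (u + v) (u + v)) <= sqrtC (f u u) + sqrtC (f v v).
Proof.
have s0 := sqrt_dnorm_ge0 f.
rewrite -(@ler_pXn2r _ 2) ?nnegrE ?addr_ge0// sqrrD !sqrtCK dnormD.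
rewrite [leRHS]addrAC lerD2l mulr2n.
have rd : f u v + (f u v)^*%R \is Num.real.
  by rewrite CrealE rmorphD /= conjCK addrC.
apply: (le_trans (real_ler_norm rd)); apply: (le_trans (ler_normD _ _)).
by rewrite norm_conjC lerD// dot_CauchySchwarz.
Qed.

Section Orthonormal.
Variables (n : nat) (e : 'I_n -> U).
Hypothesis onE : forall a b, f (e a) (e b) = (a == b)%:R.

Lemma dot_lincombl (c : 'I_n -> C) b : f (\sum_a c a *: e a) (e b) = c b.
Proof.
rewrite dot_suml (bigD1 b)//= dotZl onE eqxx mulr1 big1 ?addr0// => a /negPf ab.
by rewrite dotZl onE ab mulr0.
Qed.

Lemma dot_lincomb (c : 'I_n -> C) :
  f (\sum_a c a *: e a) (\sum_a c a *: e a) = \sum_a `|c a| ^+ 2.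
Proof.
rewrite dot_sumr; apply: eq_bigr => b _.
by rewrite dotZr dot_lincombl normCK mulrC.
Qed.

(** The residual of [x] after projection onto the span has nonnegative square, which is the
    difference of the two sides. *)
Lemma bessel x : \sum_a `|f x (e a)| ^+ 2 <= f x x.
Proof.
set p := \sum_a f x (e a) *: e a.
have := dnorm_ge0 f (x - p).
have xp : f x p = \sum_a `|f x (e a)| ^+ 2.
  by rewrite dot_sumr; apply: eq_bigr => a _; rewrite dotZr normCK mulrC.
have px : f p x = f x p.
  rewrite (dotC p x) xp rmorph_sum; apply: eq_bigr => a _.
  by rewrite /= geC0_conj// exprn_ge0.
by rewrite !(dotBl, dotBr) px {2}/p dot_lincomb -xp subrr subr0 subr_ge0.
Qed.

Lemma parseval c x : x = \sum_a c a *: e a -> \sum_a `|f x (e a)| ^+ 2 = f x x.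
Proof.
move=> ->; rewrite dot_lincomb; apply: eq_bigr => a _.
by rewrite dot_lincombl.
Qed.

End Orthonormal.

(** Induction on [s]: if the new vector has zero residual the family is kept, otherwise the
    normalized residual [w] is put in front. The family may thus be shorter than [s], and even
    empty. *)
Lemma gram_schmidt (s : seq U) : exists n (e : 'I_n -> U),
  (forall a b, f (e a) (e b) = (a == b)%:R) /\
  (forall x, x \in s -> exists c : 'I_n -> C, x = \sum_a c a *: e a).
Proof.
elim: s => [|x s [n [e [onE se]]]].
  by exists 0, (fun=> 0); split=> [[]|x] //; rewrite in_nil.
pose p := \sum_a f x (e a) *: e a.
have xp b : f (x - p) (e b) = 0 by rewrite dotBl dot_lincombl// subrr.
have [x0|x0] := eqVneq (x - p) 0.
  exists n, e; split=> // y; rewrite inE => /orP[/eqP->|/se//].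
  by exists (fun a => f x (e a)); apply/eqP; rewrite -subr_eq0; apply/eqP.
pose w := (sqrtC (f (x - p) (x - p)))^-1 *: (x - p).
have sgt0 : 0 < sqrtC (f (x - p) (x - p)) by rewrite sqrt_dnorm_gt0.
have wb b : f w (e b) = 0 by rewrite dotZl xp mulr0.
have ww : f w w = 1.
  rewrite dnormZ -[X in _ * X]sqrtCK normfV exprVn ger0_norm ?(ltW sgt0)//.
  by rewrite mulVf// expf_neq0// gt_eqF.
pose e' (i : 'I_n.+1) := oapp e w (unlift ord0 i).
have e'0 : e' ord0 = w by rewrite /e' unlift_none.
have e'S a : e' (lift ord0 a) = e a by rewrite /e' liftK.
exists n.+1, e'; split.
  move=> a b; case: (unliftP ord0 a) => [a'|] ->;
    case: (unliftP ord0 b) => [b'|] ->; rewrite ?e'0 ?e'S ?(inj_eq lift_inj)//.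
  by rewrite dotC wb conjC0.
move=> y; rewrite inE => /orP[/eqP->|/se[c ->]]; last first.
  exists (fun i => oapp c 0 (unlift ord0 i)).
  rewrite big_ord_recl unlift_none/= scale0r add0r.
  by apply: eq_bigr => a _; rewrite liftK e'S.
(* The coefficient of [w] is the length of the residual; the others are the projection
   coefficients. *)
exists (fun i => oapp (fun a => f x (e a)) (sqrtC (f (x - p) (x - p)))
                      (unlift ord0 i)).
rewrite big_ord_recl unlift_none/= e'0 /w scalerA divff ?gt_eqF// scale1r.
rewrite [X in _ + X](_ : _ = p) ?subrK//.
by apply: eq_bigr => a _; rewrite liftK e'S.
Qed.

End DotTheory.

(** * Operator norms of complex matrices *)

Section ComplexVectors.
Variable R : realType.
Local Notation C := R[i].

Lemma Re_normE (E : normedZmodType C) (x : E) : (complex.Re `|x|)%:C = `|x|.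
Proof. by have := normr_ge0 x; case: (`|x|) => a b; rewrite lecE => /andP[/eqP/= -> _]. Qed.

Lemma Re_norm_ge0 (E : normedZmodType C) (x : E) : 0 <= complex.Re `|x|.
Proof. by rewrite -ler0c Re_normE. Qed.

Lemma Re_norm_real (a : R) : 0 <= a -> complex.Re `|a%:C| = a.
Proof. by rewrite -ler0c => /ger0_norm ->. Qed.

Lemma l2norm_ge0 (E : normedZmodType C) n (xi : 'cV[E]_n) : 0 <= l2norm xi.
Proof. exact: sqrtr_ge0. Qed.

Lemma l2norm_sqr (E : normedZmodType C) n (xi : 'cV[E]_n) :
  (l2norm xi ^+ 2)%:C = \sum_i `|xi i 0| ^+ 2.
Proof.
rewrite sqr_sqrtr; last by apply: sumr_ge0 => i _; rewrite exprn_ge0 ?Re_norm_ge0.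
by rewrite rmorph_sum; apply: eq_bigr => i _; rewrite rmorphXn /= Re_normE.
Qed.

(** With this form, [mx_pos A] unfolds to [0 <= cvdot (A *m xi) xi] for all [xi]. *)
Definition cvdot n (a b : 'cV[C]_n) : C := \sum_i a i 0 * (b i 0)^*%R.

Section CvdotInstance.
Variable n : nat.

Fact cvdot_bilinear :
  bilinear_for *%R (Num.conj \; *%R : C -> C -> C) (@cvdot n).
Proof.
split=> [b|b] k x y; rewrite /cvdot /= mulr_sumr -big_split/=;
  apply: eq_bigr => i _; rewrite !mxE.
  by rewrite mulrDl mulrA.
by rewrite rmorphD rmorphM mulrDr mulrCA.
Qed.

HB.instance Definition _ :=
  bilinear_isBilinear.Build C _ _ _ _ _ (@cvdot n) cvdot_bilinear.

Fact cvdot_herm (x y : 'cV[C]_n) :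
  cvdot x y = (-1) ^+ false * Num.conj (cvdot y x).
Proof.
rewrite expr0 mul1r rmorph_sum; apply: eq_bigr => i _ /=.
by rewrite rmorphM /= conjCK mulrC.
Qed.

HB.instance Definition _ :=
  isHermitianSesquilinear.Build C _ _ _ (@cvdot n) cvdot_herm.

Fact cvdot_gt0 (x : 'cV[C]_n) : x != 0 -> 0 < cvdot x x.
Proof.
move=> x0; rewrite lt_def sumr_ge0 ?andbT => [|i _]; last exact: mul_conjC_ge0.
apply: contra x0; rewrite psumr_eq0 => [/allP H|i _]; last exact: mul_conjC_ge0.
apply/eqP/colP => i; rewrite mxE; apply/eqP.
by rewrite -mul_conjC_eq0; apply: (H i); rewrite mem_index_enum.
Qed.

HB.instance Definition _ := isDotProduct.Build C _ (@cvdot n) cvdot_gt0.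

End CvdotInstance.

Lemma cvdotE n (x : 'cV[C]_n) : cvdot x x = (l2norm x ^+ 2)%:C.
Proof. by rewrite l2norm_sqr; apply: eq_bigr => i _; rewrite normCK. Qed.

Lemma l2norm_eq0 n (x : 'cV[C]_n) : l2norm x = 0 -> x = 0.
Proof.
by move=> x0; apply/eqP; rewrite -(dnorm_eq0 (@cvdot n)) /= cvdotE x0 expr0n.
Qed.

Lemma l2norm0 (E : normedZmodType C) n : l2norm (0 : 'cV[E]_n) = 0.
Proof.
apply/eqP; rewrite -sqrf_eq0; apply/eqP/complexI.
by rewrite l2norm_sqr big1 // => i _; rewrite mxE normr0 expr0n.
Qed.

Lemma l2normZ n (a : C) (x : 'cV[C]_n) : l2norm (a *: x) = complex.Re `|a| * l2norm x.
Proof.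
apply/eqP; rewrite -(@eqrXn2 _ 2) ?mulr_ge0 ?l2norm_ge0 ?Re_norm_ge0//.
have : (l2norm (a *: x) ^+ 2)%:C = `|a| ^+ 2 * (l2norm x ^+ 2)%:C.
  by rewrite -!cvdotE (dnormZ (@cvdot n)).
by rewrite -Re_normE -rmorphXn -rmorphM -exprMn => /complexI ->.
Qed.

Lemma opnorm_le (E F : normedZmodType C) m n (f : 'cV[E]_n -> 'cV[F]_m) (c : R) :
  0 <= c -> (forall xi, l2norm (f xi) <= c * l2norm xi) -> (opnorm f <= c%:E)%E.
Proof.
move=> c0 fc; apply: ge_ereal_sup => _ [xi /= xi1 <-]; rewrite lee_fin.
by apply: (le_trans (fc xi)); rewrite ler_piMr.
Qed.

Lemma le_opnorm (E F : normedZmodType C) m n (f : 'cV[E]_n -> 'cV[F]_m) xi :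
  l2norm xi <= 1 -> ((l2norm (f xi))%:E <= opnorm f)%E.
Proof. by move=> xi1; apply: ereal_sup_ubound; exists xi. Qed.

Lemma mx_opnorm_ge0 m n (A : 'M[C]_(m, n)) : (0 <= mx_opnorm A)%E.
Proof.
apply: le_trans (@le_opnorm _ _ _ _ _ 0 _); first by rewrite lee_fin l2norm_ge0.
by rewrite -[0](scale0r (0 : 'cV[C]_n)) l2normZ normr0 mul0r.
Qed.

(** The supremum runs over the unit ball, so a nonzero [xi] is first rescaled to norm 1. *)
Lemma mx_opnorm_bound m n (A : 'M[C]_(m, n)) c xi :
  (mx_opnorm A <= c%:E)%E -> l2norm (A *m xi) <= c * l2norm xi.
Proof.
move=> Ac; have [x0|x0] := eqVneq (l2norm xi) 0.
  by rewrite (l2norm_eq0 x0) mulmx0 !l2norm0 mulr0.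
have xp : 0 < l2norm xi by rewrite lt_def x0 l2norm_ge0.
have nV : complex.Re `|((l2norm xi)^-1)%:C| = (l2norm xi)^-1.
  by rewrite ger0_norm// ler0c invr_ge0 l2norm_ge0.
have := @le_opnorm _ _ _ _ (mulmx A) ((l2norm xi)^-1%:C *: xi).
rewrite l2normZ nV mulVf// => /(_ (lexx _))/le_trans/(_ Ac).
by rewrite -scalemxAr l2normZ nV lee_fin mulrC ler_pdivrMr.
Qed.

Section MxcolSums.
Variables (k n : nat).
Let p := fun _ : 'I_k => n.

(** [tagnat.Rank] is a bijection between pairs (block, position in the block) and flat indices; the
    sum is reindexed along it. *)
Lemma sum_mxcol (T : nmodType) (g : 'I_k -> 'I_n -> T) :
  \sum_(s < (\sum_(i < k) n)%N) g (tagnat.sig1 s) (@tagnat.sig2 k p s) =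
  \sum_i \sum_a g i a.
Proof.
rewrite (reindex _ (@tagnat.rank_bij_on _ p)) (@sig_big_dep _ _ _ _ _ predT).
apply: eq_bigr => -[i a] _ /=; rewrite /tagnat.sig2 /tagnat.sig1 -/p.
by rewrite tagnat.rankK.
Qed.

Lemma cvdot_mxcol (xi eta : 'I_k -> 'cV[C]_n) :
  cvdot (\mxcol_(i < k) (xi i : 'cV_(p i))) (\mxcol_(i < k) (eta i : 'cV_(p i))) =
  \sum_i cvdot (xi i) (eta i).
Proof.
rewrite /cvdot -sum_mxcol; apply: eq_bigr => s _.
by rewrite !mxE.
Qed.

End MxcolSums.

End ComplexVectors.

(** * Unordered sums *)

#[local] Existing Instance totally_filter.

Section Sums.
Variables (R : realType) (T : choiceType).
Implicit Types (g h : T -> R) (A : {fset T}).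

Definition psum g A : R := \sum_(t <- A) g t.

Definition absummable g := exists M, forall A, psum (fun t => `|g t|) A <= M.

(** The limit is along the finite subsets directed by inclusion. Convergence of this net comes from
    absolute summability, in [is_cvg_psum]. *)
Definition rsum g : R := lim (psum g @ @totally T).

Lemma psumD g h A : psum (g \+ h) A = psum g A + psum h A.
Proof. exact: big_split. Qed.

Lemma psumZ a g A : psum (fun t => a * g t) A = a * psum g A.
Proof. by rewrite /psum mulr_sumr. Qed.

Lemma psum_ge0 g A : (forall t, 0 <= g t) -> 0 <= psum g A.
Proof. by move=> g0; apply: sumr_ge0. Qed.

Lemma le_psum g h A : (forall t, g t <= h t) -> psum g A <= psum h A.
Proof. by move=> gh; apply: ler_sum. Qed.

Lemma psum_subset g A B : (forall t, 0 <= g t) -> (A `<=` B)%fset -> psum g A <= psum g B.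
Proof.
(* Extending [g] by 0 outside [A] turns the sum over [A] into a sum over [B], where terms can be
   compared. *)
move=> g0 AB; pose g' t := if t \in A then g t else 0.
rewrite (_ : psum g A = psum g' A); last first.
  by apply: eq_big_seq => t tA; rewrite /g' tA.
rewrite [leLHS](big_fset_incl _ AB) => [|t _ /negPf tA]; last by rewrite /g' tA.
by apply: le_psum => t; rewrite /g'; case: ifP.
Qed.

Lemma psum1 g t : psum g [fset t]%fset = g t.
Proof. by rewrite /psum big_seq_fset1. Qed.

Lemma near_totally A : \forall B \near @totally T, (A `<=` B)%fset.
Proof. by exists A. Qed.

Lemma absummable_le g h :
  (forall t, `|g t| <= h t) -> absummable h -> absummable g.
Proof.
move=> gh [M hM]; exists M => A; apply: le_trans (hM A).
by apply: le_psum => t; apply: le_trans (gh t) (ler_norm _).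
Qed.

Lemma absummableD g h : absummable g -> absummable h -> absummable (g \+ h).
Proof.
move=> [M gM] [N hN]; exists (M + N) => A.
apply: le_trans (lerD (gM A) (hN A)); rewrite -psumD; apply: le_psum => t.
exact: ler_normD.
Qed.

Lemma absummableZ a g : absummable g -> absummable (fun t => a * g t).
Proof.
move=> [M gM]; exists (`|a| * M) => A; under eq_fun do rewrite normrM.
by rewrite psumZ ler_wpM2l.
Qed.

Lemma absummable_norm g : absummable g -> absummable (fun t => `|g t|).
Proof. by case=> M gM; exists M => A; under eq_fun do rewrite normr_id. Qed.

(** The net of partial sums is increasing and bounded, so it converges to its supremum. *)
Lemma ge0_is_cvg_psum g : (forall t, 0 <= g t) -> absummable g ->
  cvg (psum g @ @totally T).
Proof.
move=> g0 [M gM]; pose E := range (psum g); apply/cvg_ex.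
have hsE : has_sup E.
  split; first by exists (psum g fset0), fset0.
  exists M => _ [A _ <-]; apply: le_trans (gM A).
  by apply: le_psum => t; apply: ler_norm.
exists (sup E); apply/cvgrPdist_le => e e0.
have [_ [A _ <-] Ae] := sup_adherent e0 hsE.
exists A => // B /= AB; rewrite ler_distl; apply/andP; split; last first.
  by rewrite -lerBlDr (le_trans (ltW Ae)) ?psum_subset.
rewrite lerBlDr (@le_trans _ _ (sup E))//.
  by apply: sup_upper_bound => //; exists B.
by rewrite lerDl ltW.
Qed.

(** Write [g] as the difference of the nonnegative summable functions [g + |g|] and [|g|]. *)
Lemma is_cvg_psum g : absummable g -> cvg (psum g @ @totally T).
Proof.
move=> gs; have gs' := absummable_norm gs.
rewrite (_ : psum g = psum (g \+ (fun t => `|g t|)) \- psum (fun t => `|g t|)).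
  apply: is_cvgB; apply: ge0_is_cvg_psum => //.
    by move=> t; rewrite /= -lerBlDl sub0r -normrN ler_norm.
  exact: absummableD.
by apply/funext => A /=; rewrite psumD addrK.
Qed.

Lemma rsumD g h : absummable g -> absummable h -> rsum (g \+ h) = rsum g + rsum h.
Proof.
move=> /is_cvg_psum gs /is_cvg_psum hs; rewrite /rsum.
have -> : psum (g \+ h) = psum g \+ psum h by apply/funext => A; rewrite psumD.
exact: limD.
Qed.

Lemma rsumZ a g : absummable g -> rsum (fun t => a * g t) = a * rsum g.
Proof.
move=> /is_cvg_psum gs; rewrite /rsum.
have -> : psum (fun t => a * g t) = a *: (psum g : _ -> R^o).
  by apply/funext => A; rewrite psumZ.
exact: limZr.
Qed.

Lemma rsum_ge0 g : (forall t, 0 <= g t) -> absummable g -> 0 <= rsum g.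
Proof.
move=> g0 /is_cvg_psum gs; apply: limr_ge => //.
by apply: nearW => A; apply: psum_ge0.
Qed.

Lemma psum_le_rsum g A : (forall t, 0 <= g t) -> absummable g -> psum g A <= rsum g.
Proof.
move=> g0 /is_cvg_psum gs; apply: limr_ge => //.
by exists A => // B /=; apply: psum_subset.
Qed.

Lemma rsum_le g M : absummable g -> (forall A, psum g A <= M) -> rsum g <= M.
Proof. by move=> /is_cvg_psum gs gM; apply: limr_le => //; apply: nearW. Qed.

Lemma ge0_absummable g M : (forall t, 0 <= g t) -> (forall A, psum g A <= M) ->
  absummable g.
Proof.
move=> g0 gM; exists M => A; under eq_fun do rewrite ger0_norm//.
exact: gM.
Qed.

Lemma absummable0 : absummable (fun=> 0).
Proof. by exists 0 => A; rewrite /psum big1// => t _; rewrite normr0. Qed.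

Lemma rsum0 : rsum (fun=> 0) = 0.
Proof.
rewrite /rsum (_ : psum _ = cst 0) ?lim_cst//.
by apply/funext => A; rewrite /psum big1.
Qed.

Lemma rsum_sum (I : Type) (r : seq I) (g : I -> T -> R) :
  (forall i, absummable (g i)) ->
  absummable (fun t => \sum_(i <- r) g i t) /\
  rsum (fun t => \sum_(i <- r) g i t) = \sum_(i <- r) rsum (g i).
Proof.
move=> gs; elim: r => [|i r [IHs IH]].
  have E : (fun t => \sum_(i <- [::]) g i t) = fun=> 0.
    by apply/funext => t; rewrite big_nil.
  by rewrite E big_nil rsum0; split=> //; exact: absummable0.
have E : (fun t => \sum_(j <- i :: r) g j t) = g i \+ (fun t => \sum_(j <- r) g j t).
  by apply/funext => t; rewrite big_cons.
by rewrite E big_cons -IH; split; [exact: absummableD | exact: rsumD].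
Qed.

Lemma le_rsum g h : absummable g -> absummable h -> (forall t, g t <= h t) ->
  rsum g <= rsum h.
Proof.
move=> gs hs gh; rewrite -subr_ge0 -mulN1r -rsumZ// -rsumD//; last exact: absummableZ.
apply: rsum_ge0 => [t|]; first by rewrite /= mulN1r subr_ge0.
by apply: absummableD => //; exact: absummableZ.
Qed.

(** The partial sums are constant once the finite set contains [t0]. *)
Lemma rsum_single g t0 : (forall t, t != t0 -> g t = 0) -> rsum g = g t0.
Proof.
move=> g0; apply: cvg_lim => //; apply: cvg_near_cst.
apply: filterS (near_totally [fset t0]%fset) => A; rewrite fsub1set => t0A.
by rewrite /psum (big_fsetD1 t0)//= big1_seq ?addr0// => t; rewrite in_fsetD1 => /and3P[_ /g0].
Qed.

End Sums.

Section ComplexSums.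
Variables (R : realType) (T : choiceType).
Local Notation C := R[i].
Implicit Types F G : T -> C.

Definition csummable F :=
  absummable (fun t => complex.Re (F t)) /\ absummable (fun t => complex.Im (F t)).

Definition csum F : C :=
  rsum (fun t => complex.Re (F t)) +i* rsum (fun t => complex.Im (F t)).

Lemma csummable_le F (h : T -> R) :
  (forall t, `|F t| <= (h t)%:C) -> absummable h -> csummable F.
Proof.
move=> Fh hs; split; apply: absummable_le hs => t;
  rewrite -lecR; apply: le_trans (Fh t); case: (F t) => a b /=; simpc; 
  rewrite -sqrtr_sqr ler_wsqrtr// ?lerDl ?lerDr ?sqr_ge0//.
Qed.

Lemma csummableD F G : csummable F -> csummable G -> csummable (fun t => F t + G t).
Proof.
move=> [Fr Fi] [Gr Gi]; split.
  rewrite (_ : (fun t => _) =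
    (fun t => complex.Re (F t)) \+ (fun t => complex.Re (G t))).
    exact: absummableD.
  by apply/funext => t /=; rewrite raddfD.
rewrite (_ : (fun t => _) =
    (fun t => complex.Im (F t)) \+ (fun t => complex.Im (G t))).
  exact: absummableD.
by apply/funext => t /=; rewrite raddfD.
Qed.

Lemma csumD F G : csummable F -> csummable G ->
  csum (fun t => F t + G t) = csum F + csum G.
Proof.
move=> [Fr Fi] [Gr Gi]; rewrite /csum.
under [in LHS]eq_fun do rewrite raddfD.
under [X in _ +i* rsum X = _]eq_fun do rewrite raddfD.
by rewrite (rsumD Fr Gr) (rsumD Fi Gi).
Qed.

Lemma csummableZ a F : csummable F -> csummable (fun t => a * F t).
Proof.
case: a => a b [Fr Fi]; split.
  rewrite (_ : (fun t => _) = (fun t => a * complex.Re (F t)) \+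
      (fun t => - b * complex.Im (F t))).
    by apply: absummableD; apply: absummableZ.
  by apply/funext => t /=; case: (F t) => x y /=; rewrite mulNr.
rewrite (_ : (fun t => _) = (fun t => a * complex.Im (F t)) \+
    (fun t => b * complex.Re (F t))).
  by apply: absummableD; apply: absummableZ.
by apply/funext => t /=; case: (F t).
Qed.

Lemma csumZ a F : csummable F -> csum (fun t => a * F t) = a * csum F.
Proof.
case: a => a b [Fr Fi]; rewrite /csum.
rewrite (_ : (fun t => complex.Re _) = (fun t => a * complex.Re (F t)) \+
    (fun t => - b * complex.Im (F t))); last first.
  by apply/funext => t /=; case: (F t) => x y /=; rewrite mulNr.
rewrite (_ : (fun t => complex.Im _) = (fun t => a * complex.Im (F t)) \+
    (fun t => b * complex.Re (F t))); last first.
  by apply/funext => t /=; case: (F t).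
by rewrite !rsumD ?rsumZ; do ?exact: absummableZ; rewrite // mulNr.
Qed.

Lemma csum_conj F : csummable F -> csum (fun t => (F t)^*%R) = (csum F)^*%R.
Proof.
move=> [Fr Fi]; rewrite /csum (_ : (fun t => complex.Im _) =
    (fun t => -1 * complex.Im (F t))); last first.
  by apply/funext => t /=; case: (F t) => x y /=; rewrite mulN1r.
rewrite rsumZ// mulN1r [RHS]/=; congr (rsum _ +i* _).
by apply/funext => t; case: (F t).
Qed.

Lemma csum_ge0 F : (forall t, 0 <= F t) -> csummable F -> 0 <= csum F.
Proof.
move=> F0 [Fr Fi]; have FE t : F t = (complex.Re (F t))%:C.
  by have := F0 t; case: (F t) => a b; rewrite lecE => /andP[/eqP/= -> _].
(* Nonnegative elements of [R[i]] have zero imaginary part; writing it as [0 *] a summable family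
   lets [rsumZ] evaluate its sum. *)
rewrite /csum (_ : (fun t => complex.Im _) = (fun t => 0 * complex.Re (F t))).
  rewrite rsumZ// mul0r ler0c; apply: rsum_ge0 => // t.
  by have := F0 t; rewrite FE ler0c.
by apply/funext => t; rewrite FE /= mul0r.
Qed.

Lemma csum_real (g : T -> R) : absummable g -> csum (fun t => (g t)%:C) = (rsum g)%:C.
Proof.
move=> gs; rewrite /csum (_ : (fun t => complex.Im _) = (fun t => 0 * g t)).
  by rewrite rsumZ// mul0r.
by apply/funext => t; rewrite /= mul0r.
Qed.

Lemma csum_sum (I : Type) (r : seq I) (F : I -> T -> C) :
  (forall i, csummable (F i)) ->
  csummable (fun t => \sum_(i <- r) F i t) /\
  csum (fun t => \sum_(i <- r) F i t) = \sum_(i <- r) csum (F i).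
Proof.
move=> Fs; elim: r => [|i r [IHs IH]].
  have E : (fun t => \sum_(i <- [::]) F i t) = fun t => (0 : R)%:C.
    by apply/funext => t; rewrite big_nil.
  have s0 := absummable0 R T.
  by rewrite E big_nil csum_real// rsum0; split.
have E : (fun t => \sum_(j <- i :: r) F j t) = fun t => F i t + \sum_(j <- r) F j t.
  by apply/funext => t; rewrite big_cons.
by rewrite E big_cons -IH; split; [exact: csummableD | exact: csumD].
Qed.

Lemma csum_single F t0 : (forall t, t != t0 -> F t = 0) -> csum F = F t0.
Proof.
move=> F0; rewrite /csum !(@rsum_single _ _ _ t0); first by case: (F t0).
  by move=> t /F0 ->.
by move=> t /F0 ->.
Qed.

End ComplexSums.

(** * Hilbert direct sums of finite-dimensional spaces *)

Lemma cvg_sumr (R : realType) (T I : Type) (F : set_system T) (FF : Filter F)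
    (r : seq I) (g : I -> T -> R) (l : I -> R) :
  (forall i, g i @ F --> l i) ->
  (fun x => \sum_(i <- r) g i x) @ F --> \sum_(i <- r) l i.
Proof. by move=> gl; apply: (cvg_big add_continuous). Qed.

Section HilbertSum.
Variables (R : realType) (S : choiceType) (d : S -> nat).
Local Notation C := R[i].

(** The full product of the summands, under its own name so that a module structure can be attached;
    [hsum] is its submodule of square-summable families. *)
Definition cvfam := forall s, 'cV[C]_(d s).

Identity Coercion fun_of_cvfam : cvfam >-> Funclass.

HB.instance Definition _ := Choice.copy cvfam (forall s, 'cV[C]_(d s)).

Fact cvfam_addA : associative (fun f g : cvfam => (fun s => f s + g s) : cvfam).
Proof. by move=> f g h; apply: functional_extensionality_dep => s; rewrite addrA. Qed.
Fact cvfam_addC : commutative (fun f g : cvfam => (fun s => f s + g s) : cvfam).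
Proof. by move=> f g; apply: functional_extensionality_dep => s; rewrite addrC. Qed.
Fact cvfam_add0 : left_id ((fun s => 0) : cvfam)
  (fun f g : cvfam => (fun s => f s + g s) : cvfam).
Proof. by move=> f; apply: functional_extensionality_dep => s; rewrite add0r. Qed.
Fact cvfam_addN : left_inverse ((fun s => 0) : cvfam)
  (fun f : cvfam => (fun s => - f s) : cvfam)
  (fun f g : cvfam => (fun s => f s + g s) : cvfam).
Proof. by move=> f; apply: functional_extensionality_dep => s; rewrite addNr. Qed.

HB.instance Definition _ :=
  GRing.isZmodule.Build cvfam cvfam_addA cvfam_addC cvfam_add0 cvfam_addN.

Fact cvfam_scaleA (a b : C) (f : cvfam) :
  ((fun s => a *: (b *: f s)) : cvfam) = (fun s => (a * b) *: f s).
Proof. by apply: functional_extensionality_dep => s; rewrite scalerA. Qed.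
Fact cvfam_scale1 (f : cvfam) : ((fun s => 1 *: f s) : cvfam) = f.
Proof. by apply: functional_extensionality_dep => s; rewrite scale1r. Qed.
Fact cvfam_scaleDr (a : C) (f g : cvfam) :
  ((fun s => a *: (f + g) s) : cvfam) = ((fun s => a *: f s) : cvfam) + (fun s => a *: g s).
Proof. by apply: functional_extensionality_dep => s; rewrite scalerDr. Qed.
Fact cvfam_scaleDl (f : cvfam) (a b : C) :
  ((fun s => (a + b) *: f s) : cvfam) = ((fun s => a *: f s) : cvfam) + (fun s => b *: f s).
Proof. by apply: functional_extensionality_dep => s; rewrite scalerDl. Qed.

HB.instance Definition _ := GRing.Zmodule_isLmodule.Build C cvfam
  cvfam_scaleA cvfam_scale1 cvfam_scaleDr cvfam_scaleDl.

Lemma cvfamDE (f g : cvfam) s : (f + g) s = f s + g s. Proof. by []. Qed.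
Lemma cvfamZE a (f : cvfam) s : (a *: f) s = a *: f s. Proof. by []. Qed.

Definition sqsum_pred : {pred cvfam} :=
  fun f => `[< absummable (fun s => l2norm (f s) ^+ 2) >].

Lemma l2norm_sqrD n (x y : 'cV[C]_n) :
  l2norm (x + y) ^+ 2 <= 2 * l2norm x ^+ 2 + 2 * l2norm y ^+ 2.
Proof.
have := dot_sqnormD_le (@cvdot R n) x y; rewrite /= !cvdotE.
by rewrite -(rmorph_nat (real_complex R)) -!rmorphM -rmorphD lecR.
Qed.

Fact sqsum_closed : submod_closed sqsum_pred.
Proof.
split.
  apply/asboolP; exists 0 => A; rewrite /psum big1// => s _.
  by rewrite l2norm0 expr0n normr0.
move=> a f g /asboolP sf /asboolP sg; apply/asboolP.
have := absummableD (absummableZ (complex.Re `|a| ^+ 2 * 2) sf) (absummableZ 2 sg).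
apply: absummable_le => s; rewrite ger0_norm ?exprn_ge0 ?l2norm_ge0//= cvfamDE cvfamZE.
apply: (le_trans (l2norm_sqrD _ _)).
by rewrite lerD2r l2normZ exprMn mulrA [2 * _]mulrC.
Qed.

HB.instance Definition _ := GRing.isSubmodClosed.Build C cvfam sqsum_pred sqsum_closed.

Record hsum := Hsum { hsum_val :> cvfam; _ : hsum_val \in sqsum_pred }.

HB.instance Definition _ := [isSub for hsum_val].
HB.instance Definition _ := [Choice of hsum by <:].
HB.instance Definition _ := [SubChoice_isSubLmodule of hsum by <:].

Implicit Types f g h : hsum.

Lemma hsumP f g : (forall s, f s = g s) -> f = g.
Proof. by move=> fg; apply/val_inj/functional_extensionality_dep. Qed.

Lemma hsum_absummable f : absummable (fun s => l2norm (f s) ^+ 2).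
Proof. by case: f => f /= /asboolP. Qed.

Definition hsumdot f g : C := csum (fun s => cvdot (f s) (g s)).

Lemma cvdot_le n (x y : 'cV[C]_n) :
  `|cvdot x y| <= (l2norm x ^+ 2 + l2norm y ^+ 2)%:C.
Proof. by rewrite rmorphD /= -!cvdotE; exact: (dot_norm_le (@cvdot R n)). Qed.

Lemma hsumdot_csummable f g : csummable (fun s => cvdot (f s) (g s)).
Proof.
apply: csummable_le (absummableD (hsum_absummable f) (hsum_absummable g)) => s.
exact: cvdot_le.
Qed.

Lemma hsumdotE f : hsumdot f f = (rsum (fun s => l2norm (f s) ^+ 2))%:C.
Proof.
rewrite -csum_real; last exact: hsum_absummable.
by congr csum; apply/funext => s; rewrite cvdotE.
Qed.

Fact hsumdot_bilinear :
  bilinear_for *%R (Num.conj \; *%R : C -> C -> C) hsumdot.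
Proof.
split=> [h|h] k f g; rewrite /hsumdot /=.
  rewrite -csumZ -?csumD; do ?exact: hsumdot_csummable.
    congr csum; apply/funext => s.
    by rewrite cvfamDE cvfamZE (dotDl (@cvdot R _)) (dotZl (@cvdot R _)).
  exact/csummableZ/hsumdot_csummable.
rewrite -csumZ -?csumD; do ?exact: hsumdot_csummable.
  congr csum; apply/funext => s.
  by rewrite cvfamDE cvfamZE (dotDr (@cvdot R _)) (dotZr (@cvdot R _)).
exact/csummableZ/hsumdot_csummable.
Qed.

HB.instance Definition _ :=
  bilinear_isBilinear.Build C _ _ _ _ _ hsumdot hsumdot_bilinear.

Fact hsumdot_herm f g : hsumdot f g = (-1) ^+ false * Num.conj (hsumdot g f).
Proof.
rewrite expr0 mul1r -csum_conj; last exact: hsumdot_csummable.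
by congr csum; apply/funext => s; rewrite (dotC (@cvdot R _)).
Qed.

HB.instance Definition _ :=
  isHermitianSesquilinear.Build C _ _ _ hsumdot hsumdot_herm.

Lemma l2norm_le_hsumdot f s : (l2norm (f s) ^+ 2)%:C <= hsumdot f f.
Proof.
rewrite hsumdotE lecR -(psum1 (fun s => l2norm (f s) ^+ 2)).
by apply: psum_le_rsum => [t|]; [exact: sqr_ge0 | exact: hsum_absummable].
Qed.

Fact hsumdot_gt0 f : f != 0 -> 0 < hsumdot f f.
Proof.
move=> f0; rewrite lt_def; apply/andP; split; last first.
  by apply: csum_ge0 => [s|]; [exact: dnorm_ge0 | exact: hsumdot_csummable].
apply: contra f0 => /eqP ff; apply/eqP/hsumP => s; apply: l2norm_eq0; apply/eqP.
by rewrite -sqrf_eq0 eq_le sqr_ge0 andbT -lecR -[leRHS]ff l2norm_le_hsumdot.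
Qed.

HB.instance Definition _ := isDotProduct.Build C _ hsumdot hsumdot_gt0.

Definition hsumnorm f : C := sqrtC (hsumdot f f).

Fact hsumnormZ (a : C) f : hsumnorm (a *: f) = `|a| * hsumnorm f.
Proof.
rewrite /hsumnorm (dnormZ hsumdot) sqrtCM ?qualifE/= ?exprn_ge0 ?dnorm_ge0//.
by rewrite sqrCK.
Qed.

Fact hsumnorm_eq0 f : hsumnorm f = 0 -> f = 0.
Proof. by move/eqP; rewrite (sqrt_dnorm_eq0 hsumdot) => /eqP. Qed.

HB.instance Definition _ := Lmodule_isNormed.Build C hsum
  (dot_triangle hsumdot) hsumnormZ hsumnorm_eq0.

Lemma hsum_norm_sqr f : `|f| ^+ 2 = (rsum (fun s => l2norm (f s) ^+ 2))%:C.
Proof. by rewrite -hsumdotE; exact: sqrtCK. Qed.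

Lemma coord_le_norm f s j : `|f s j 0| <= `|f|.
Proof.
rewrite -(@ler_pXn2r _ 2)// ?nnegrE// hsum_norm_sqr -hsumdotE.
apply: le_trans (l2norm_le_hsumdot f s); rewrite l2norm_sqr (bigD1 j)//= lerDl.
by apply: sumr_ge0 => i _; rewrite exprn_ge0.
Qed.

Lemma l2norm_sqr_ReIm n (x : 'cV[C]_n) :
  l2norm x ^+ 2 = \sum_i (complex.Re (x i 0) ^+ 2 + complex.Im (x i 0) ^+ 2).
Proof.
apply: complexI; rewrite l2norm_sqr rmorph_sum; apply: eq_bigr => i _.
by case: (x i 0) => a b; rewrite normc_def -rmorphXn sqr_sqrtr ?addr_ge0 ?sqr_ge0.
Qed.

(** * Completeness of the direct sum *)

Section Completeness.
Variable F : set_system hsum.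
Hypotheses (FF : ProperFilter F) (Fc : cauchy F).

(** The Cauchy property restated with a single set of the filter, any two of whose points are
    [e]-close. *)
Let small (e : R) : 0 < e -> exists P, F P /\ forall f g, P f -> P g -> `|f - g| <= e%:C.
Proof.
move=> e0; have e0' : 0 < e%:C by rewrite ltcR.
have /cauchy_ballP/(_ _ e0')[[P Q] /= [FP FQ] PQ] := Fc.
exists (P `&` Q); split; first exact: filterI.
by move=> f g [Pf _] [_ Qg]; have := PQ (f, g) (conj Pf Qg); rewrite -ball_normE /= => /ltW.
Qed.

(** For [p] the real or imaginary part, a coordinate is 1-Lipschitz on [hsum], so convergence
    reduces to completeness of [R]. Taking [e / 2] yields the strict inequality of balls. *)
Let coord_cvg (p : C -> R) s j : (forall z w, `|p z - p w| <= complex.Re `|z - w|) ->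
  cvg ((fun f : hsum => p (f s j 0)) @ F).
Proof.
move=> pl; apply: cauchy_cvg; apply/cauchy_ballP => e e0.
have [P [FP PP]] := small (divr_gt0 e0 (@ltr0Sn _ 1)).
pose r (f : hsum) := p (f s j 0).
have Fr : F (r @^-1` (r @` P)) by apply: filterS FP => f Pf; exists f.
exists (r @` P, r @` P) => //.
move=> [_ _] [[f Pf <-] [g Pg <-]]; rewrite -ball_normE /=.
apply: (le_lt_trans (pl _ _)); rewrite -ltcR Re_normE.
have -> : f s j 0 - g s j 0 = (f - g : hsum) s j 0 by rewrite !mxE.
apply: (le_lt_trans (coord_le_norm (f - g) j)); apply: (le_lt_trans (PP _ _ Pf Pg)).
by rewrite ltcR ltr_pdivrMr// ltr_pMr// ltr1n.
Qed.

Let limRe s (j : 'I_(d s)) := lim ((fun f : hsum => complex.Re (f s j 0)) @ F).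
Let limIm s (j : 'I_(d s)) := lim ((fun f : hsum => complex.Im (f s j 0)) @ F).
Let limfam : cvfam := fun s => \col_(j < d s) (limRe j +i* limIm j).

Let limRe_cvg s (j : 'I_(d s)) : (fun f : hsum => complex.Re (f s j 0)) @ F --> limRe j.
Proof.
apply: (@coord_cvg (@complex.Re R)) => -[a b] [a' b'] /=.
by rewrite -[leLHS]sqrtr_sqr ler_wsqrtr// lerDl sqr_ge0.
Qed.

Let limIm_cvg s (j : 'I_(d s)) : (fun f : hsum => complex.Im (f s j 0)) @ F --> limIm j.
Proof.
apply: (@coord_cvg (@complex.Im R)) => -[a b] [a' b'] /=.
by rewrite -[leLHS]sqrtr_sqr ler_wsqrtr// lerDr sqr_ge0.
Qed.

(** A finite partial sum of squared distances is a polynomial in finitely many real coordinates,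
    each of which converges. *)
Let psum_cvg (g : hsum) A :
  (fun f : hsum => psum (fun s => l2norm ((f - g : hsum) s) ^+ 2) A) @ F -->
  psum (fun s => l2norm (limfam s - g s) ^+ 2) A.
Proof.
apply: cvg_sumr => s; under eq_fun do rewrite l2norm_sqr_ReIm.
rewrite l2norm_sqr_ReIm; apply: cvg_sumr => j; rewrite !mxE /=.
have cRe : (fun f : hsum => complex.Re ((f - g : hsum) s j 0)) @ F -->
    limRe j - complex.Re (g s j 0).
  rewrite (_ : (fun _ => _) = (fun f : hsum => complex.Re (f s j 0)) -
      cst (complex.Re (g s j 0))).
    by apply: cvgB; [exact: limRe_cvg | exact: cvg_cst].
  by apply/funext => f /=; rewrite !mxE raddfB.
have cIm : (fun f : hsum => complex.Im ((f - g : hsum) s j 0)) @ F -->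
    limIm j - complex.Im (g s j 0).
  rewrite (_ : (fun _ => _) = (fun f : hsum => complex.Im (f s j 0)) -
      cst (complex.Im (g s j 0))).
    by apply: cvgB; [exact: limIm_cvg | exact: cvg_cst].
  by apply/funext => f /=; rewrite !mxE raddfB.
rewrite !raddfB /= !expr2.
by apply: cvgD; apply: cvgM.
Qed.

(** Norms of differences bound all finite partial sums, and these bounds survive the coordinatewise
    limit. The resulting estimate [key] shows both that the limit family is square-summable and that
    the filter converges to it in norm. *)
Fact hsum_complete : cvg F.
Proof.
have key e : 0 < e -> exists P, F P /\ forall g, P g -> forall A,
    psum (fun s => l2norm (limfam s - g s) ^+ 2) A <= e ^+ 2.
  move=> e0; have [P [FP PP]] := small e0; exists P; split=> // g Pg A.
  apply: (cvgr_to_le (psum_cvg (g := g) (A := A))); apply: filterS FP => f Pf.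
  apply: (@le_trans _ _ (rsum (fun s => l2norm ((f - g : hsum) s) ^+ 2))).
    by apply: psum_le_rsum => [s|]; [exact: sqr_ge0 | exact: hsum_absummable].
  by rewrite -lecR -hsum_norm_sqr rmorphXn lerXn2r ?nnegrE ?PP // ler0c ltW.
have lim_sum : limfam \in sqsum_pred.
  have [P [FP PP]] := key _ ltr01; have [g Pg] := filter_ex FP.
  (* The limit is [g] plus a family whose partial sums of squares are bounded by [key]. *)
  rewrite -[limfam](subrK (g : cvfam)) rpredD ?(valP g)//.
  by apply/asboolP; apply: ge0_absummable (PP g Pg) => s; exact: sqr_ge0.
apply/cvg_ex; exists (Hsum lim_sum); apply/cvgrPdist_le => e e0.
(* Radii live in [R[i]]; positivity makes [e] real. *)
have eE : e = (complex.Re e)%:C.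
  by move: e0; case: e => a b; rewrite ltcE => /andP[/eqP/= -> _].
have e0' : 0 < complex.Re e by rewrite -ltcR -eE.
have [P [FP PP]] := key _ e0'; apply: filterS FP => g Pg.
rewrite -(@ler_pXn2r _ 2)// ?nnegrE ?(ltW e0)// hsum_norm_sqr eE -rmorphXn lecR.
by apply: rsum_le (PP g Pg); exact: (hsum_absummable (Hsum lim_sum - g)).
Qed.

End Completeness.

HB.instance Definition _ := Uniform_isComplete.Build hsum hsum_complete.

Definition hsum_hilbert : hilbertType R :=
  @HilbertType R hsum hsumdot (fun x => esym (sqrtCK _)).

End HilbertSum.

(** * Amplifications and matrix states *)

(* The constant block-size function is let-bound as [p] so that the dimension of
   [\mxcol] is elaborated to the same sum as that of [ampl]. *)
Section Amplification.
Variables (R : realType) (V : matNormedType R).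
Local Notation C := R[i].

Lemma ampl_mxcol n (phi : V -> 'M[C]_n) k (x : 'M[V]_k) (eta : 'I_k -> 'cV[C]_n)
    (p := fun _ : 'I_k => n) :
  ampl phi x *m \mxcol_(j < k) (eta j : 'cV_(p j)) =
  \mxcol_(i < k) (\sum_j phi (x i j) *m eta j : 'cV_(p i)).
Proof. exact: mul_mxblock_mxrow. Qed.

Lemma mxcol_surj n k (p := fun _ : 'I_k => n) (xi : 'cV[C]_(\sum_(i < k) p i)) :
  exists eta : 'I_k -> 'cV[C]_n, xi = \mxcol_(j < k) (eta j : 'cV_(p j)).
Proof. by exists (fun j => submxcol xi j); rewrite submxcolK. Qed.

Lemma amplD n (phi : {linear V -> 'M[C]_n}) k (x y : 'M[V]_k) :
  ampl phi (x + y) = ampl phi x + ampl phi y.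
Proof. by apply/matrixP => i j; rewrite !mxE linearD mxE. Qed.

Lemma amplZ n (phi : {linear V -> 'M[C]_n}) k a (x : 'M[V]_k) :
  ampl phi (map_mx ( *:%R a) x) = a *: ampl phi x.
Proof. by apply/matrixP => i j; rewrite !mxE linearZ mxE. Qed.

Lemma ampl_unit n (phi : {linear V -> 'M[C]_n}) u : phi u = 1%:M ->
  ampl phi (const_mx u : 'M[V]_1) = 1%:M.
Proof.
move=> phiu; apply/matrixP => i j; rewrite !mxE phiu mxE; congr (_%:R).
(* With a single block, an index is determined by its position inside that block. *)
have sigE k : k = @tagnat.Rank 1 (fun=> n) 0 (tagnat.sig2 k).
  rewrite -[LHS]tagnat.sig2K; move: (tagnat.sig1 k) (tagnat.sig2 k) => s t.
  by rewrite (ord1 s).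
by congr (nat_of_bool _); apply/eqP/eqP => [ij|->//]; rewrite (sigE i) (sigE j) ij.
Qed.

Lemma mxnorm0 k : mxnorm (0 : 'M[V]_k.+1) = 0.
Proof.
rewrite (_ : 0 = map_mx ( *:%R 0) 0); first by rewrite mxnormZ normr0 mul0r.
by apply/matrixP => i j; rewrite !mxE scale0r.
Qed.

Lemma mxnormN k (x : 'M[V]_k.+1) : mxnorm (- x) = mxnorm x.
Proof.
rewrite (_ : - x = map_mx ( *:%R (-1)) x); first by rewrite mxnormZ normrN1 mul1r.
by apply/matrixP => i j; rewrite !mxE scaleN1r.
Qed.

(** From the triangle inequality and symmetry, 0 = ||x - x|| <= 2 ||x||. *)
Lemma mxnorm_ge0 k (x : 'M[V]_k.+1) : 0 <= mxnorm x.
Proof.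
by have := @mxnormD R V k x (- x); rewrite subrr mxnorm0 mxnormN -mulr2n pmulrn_lge0.
Qed.

Lemma mxnorm_gt0 k (x : 'M[V]_k.+1) : x != 0 -> 0 < mxnorm x.
Proof.
by move=> x0; rewrite lt_def mxnorm_ge0 andbT; apply: contra x0 => /eqP/mxnorm_eq0->.
Qed.

Lemma mxnorm_normalize k (x : 'M[V]_k.+1) : x != 0 ->
  mxnorm (map_mx ( *:%R (mxnorm x)^-1%:C) x) = 1.
Proof.
move=> /mxnorm_gt0 xp; rewrite mxnormZ Re_norm_real ?invr_ge0 ?mxnorm_ge0//.
by rewrite mulVf ?gt_eqF.
Qed.

Lemma mxstate_contractive u n (phi : {linear V -> 'M[C]_n}) k (x : 'M[V]_k.+1) :
  mxstates u phi -> (mx_opnorm (ampl phi x) <= (mxnorm x)%:E)%E.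
Proof.
case=> _ cb1 _; have [->|x0] := eqVneq x 0.
  rewrite mxnorm0; apply: opnorm_le => // xi.
  have -> : ampl phi (0 : 'M[V]_k.+1) = 0.
    by apply/matrixP => i j; rewrite !mxE linear0 mxE.
  by rewrite mul0mx l2norm0 mul0r.
have xp := mxnorm_gt0 x0; have y1 := mxnorm_normalize x0.
set y := map_mx _ _ in y1.
have xE : x = map_mx ( *:%R (mxnorm x)%:C) y.
  apply/matrixP => i j; rewrite !mxE scalerA -rmorphM divff ?gt_eqF//.
  by rewrite scale1r.
have cby : (mx_opnorm (ampl phi y) <= 1%:E)%E.
  apply: le_trans cb1; apply: (@le_trans _ _ (amplnorm phi k)).
    by apply: ereal_sup_ubound; exists y; rewrite //= y1.
  by apply: ereal_sup_ubound; exists k.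
apply: opnorm_le => [|xi]; first exact: ltW.
rewrite {1}xE amplZ -scalemxAl l2normZ Re_norm_real ?mxnorm_ge0// ler_pM2l//.
by rewrite -[leRHS]mul1r; apply: mx_opnorm_bound.
Qed.

End Amplification.

(** * From an operator system to states and cones *)

Section Compression.
Variables (R : realType) (V : matNormedType R) (K : hilbertType R).
Variable Phi : {linear V -> (K -> K)}.
Hypothesis Phi_bounded : forall v, bounded_op (Phi v).
Local Notation C := R[i].
Local Notation dot := (hdot K).

Lemma PhiD v x y : Phi v (x + y) = Phi v x + Phi v y.
Proof. by have [lin _] := Phi_bounded v; have := lin 1 x y; rewrite !scale1r. Qed.

Lemma Phi0 v : Phi v 0 = 0.
Proof. by apply: (@addrI _ (Phi v 0)); rewrite -PhiD !addr0. Qed.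

Lemma PhiZ v a x : Phi v (a *: x) = a *: Phi v x.
Proof. by have [lin _] := Phi_bounded v; have := lin a x 0; rewrite !addr0 Phi0 addr0. Qed.

Lemma Phi_sum v n (F : 'I_n -> K) : Phi v (\sum_i F i) = \sum_i Phi v (F i).
Proof. by apply: (big_morph (Phi v)) => [x y|]; rewrite ?PhiD ?Phi0. Qed.

Lemma op_appE k (x : 'M[V]_k) (xi : 'cV[K]_k) i :
  op_app (map_mx Phi x) xi i 0 = \sum_j Phi (x i j) (xi j 0).
Proof. by rewrite mxE; apply: eq_bigr => j _; rewrite mxE. Qed.

Section OrthonormalFamily.
Variables (n : nat) (e : 'I_n -> K).
Hypothesis onE : forall a b, dot (e a) (e b) = (a == b)%:R.

(** The matrix, in the basis [e], of the compression of [Phi v] to the span of [e]. *)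
Definition compress (v : V) : 'M[C]_n := \matrix_(a, b) dot (Phi v (e b)) (e a).

Fact compress_linear : linear compress.
Proof.
move=> a v w; apply/matrixP => i j; rewrite !mxE linearP.
by rewrite [in LHS]/GRing.scale /= dotDl dotZl.
Qed.

HB.instance Definition _ := GRing.isLinear.Build C V 'M[C]_n _ compress compress_linear.

Definition lincomb (c : 'cV[C]_n) : K := \sum_b c b 0 *: e b.

Lemma compress_mul v c a : (compress v *m c) a 0 = dot (Phi v (lincomb c)) (e a).
Proof.
rewrite mxE Phi_sum dot_suml; apply: eq_bigr => b _.
by rewrite mxE PhiZ dotZl mulrC.
Qed.

Lemma compress_ampl k (x : 'M[V]_k) (eta : 'I_k -> 'cV[C]_n) (p := fun _ : 'I_k => n) :
  ampl compress x *m \mxcol_(j < k) (eta j : 'cV_(p j)) =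
  \mxcol_(i < k) ((\col_a dot (op_app (map_mx Phi x)
    (\col_j lincomb (eta j)) i 0) (e a)) : 'cV_(p i)).
Proof.
rewrite ampl_mxcol; congr mxcol; apply: functional_extensionality_dep => i.
apply/colP => a; rewrite summxE mxE op_appE dot_suml.
by apply: eq_bigr => j _; rewrite compress_mul mxE.
Qed.

(** Orthonormality of [e] makes the passage from coefficients to vectors isometric in each block. *)
Lemma l2norm_lincomb k (eta : 'I_k -> 'cV[C]_n) (p := fun _ : 'I_k => n) :
  l2norm (\col_j lincomb (eta j)) = l2norm (\mxcol_(j < k) (eta j : 'cV_(p j))).
Proof.
apply/eqP; rewrite -(@eqrXn2 _ 2) ?l2norm_ge0//; apply/eqP/complexI.
rewrite l2norm_sqr -cvdotE cvdot_mxcol; apply: eq_bigr => j _.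
by rewrite mxE -hdotE dot_lincomb// cvdotE l2norm_sqr.
Qed.

Lemma cvdot_dots (z : K) (c := \col_a dot z (e a)) :
  cvdot c c = \sum_a `|dot z (e a)| ^+ 2.
Proof. by rewrite cvdotE l2norm_sqr; apply: eq_bigr => a _; rewrite mxE. Qed.

(** Projecting each component of the image onto the span of [e] does not increase its norm, by
    Bessel. *)
Lemma compress_ampl_le k (x : 'M[V]_k) (eta : 'I_k -> 'cV[C]_n) (p := fun _ : 'I_k => n) :
  l2norm (ampl compress x *m \mxcol_(j < k) (eta j : 'cV_(p j))) <=
  l2norm (op_app (map_mx Phi x) (\col_j lincomb (eta j))).
Proof.
rewrite -(@ler_pXn2r _ 2) ?nnegrE ?l2norm_ge0// -lecR -cvdotE compress_ampl cvdot_mxcol.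
rewrite l2norm_sqr; apply: ler_sum => i _; rewrite cvdot_dots -hdotE.
exact: bessel.
Qed.

(** When the image already lies in the span, Parseval replaces Bessel and no norm is lost. *)
Lemma compress_ampl_eq k (x : 'M[V]_k) (eta : 'I_k -> 'cV[C]_n) (p := fun _ : 'I_k => n) :
  (forall i, exists c : 'I_n -> C,
    op_app (map_mx Phi x) (\col_j lincomb (eta j)) i 0 = \sum_a c a *: e a) ->
  l2norm (ampl compress x *m \mxcol_(j < k) (eta j : 'cV_(p j))) =
  l2norm (op_app (map_mx Phi x) (\col_j lincomb (eta j))).
Proof.
move=> xspan; apply/eqP; rewrite -(@eqrXn2 _ 2) ?l2norm_ge0//; apply/eqP/complexI.
rewrite -cvdotE compress_ampl cvdot_mxcol l2norm_sqr; apply: eq_bigr => i _.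
by have [c xc] := xspan i; rewrite cvdot_dots -hdotE (parseval onE xc).
Qed.

Hypothesis Phi_isometric : forall k (x : 'M[V]_k.+1),
  opnorm (op_app (map_mx Phi x)) = (mxnorm x)%:E.

Lemma compress_state u : Phi u = idfun -> mxstates u compress.
Proof.
move=> Phiu; have cb1 : (cbnorm compress <= 1)%E.
  apply: ge_ereal_sup => _ [k _ <-]; apply: ge_ereal_sup => _ [x /= x1 <-].
  apply: ge_ereal_sup => _ [xi /= xi1 <-].
  have [eta xiE] := mxcol_surj xi; rewrite xiE lee_fin in xi1 *.
  apply: (le_trans (compress_ampl_le _ _)).
  rewrite -lee_fin; apply: (@le_trans _ _ (mxnorm x)%:E); last by rewrite lee_fin.
  by rewrite -Phi_isometric; apply: le_opnorm; rewrite l2norm_lincomb.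
split=> //; first exact: le_lt_trans cb1 (ltry _).
by apply/matrixP => a b; rewrite !mxE Phiu /= onE eq_sym.
Qed.

End OrthonormalFamily.
End Compression.

(** * Numerical ranges, the index, and the spanning property *)

Section OrderUnit.
Variables (R : realType) (V : matNormedType R) (u : V).
Hypothesis hu : vnorm u = 1.
Local Notation C := R[i].

Lemma gamma_le_mxnorm k (x : 'M[V]_k.+1) : (gamma u x <= (mxnorm x)%:E)%E.
Proof.
by apply: ge_ereal_sup => _ [n [phi phiS ->]]; exact: mxstate_contractive phiS.
Qed.

(** Here [a + i b] stands for a value of the quadratic form of [v], [c] for the norm of [v] and [q]
    for the squared length of the vector. The terms in [t^2] cancel, so the remaining linear term in
    [t] must vanish; [t = 0] then bounds [a]. *)
Lemma numerical_range_bound (a b c q : R) : 0 <= c -> 0 <= q ->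
  (forall t, a ^+ 2 + (b + t * q) ^+ 2 <= (c ^+ 2 + t ^+ 2) * q ^+ 2) ->
  b = 0 /\ 0 <= a + c * q.
Proof.
move=> c0 q0 H.
have b0 : b = 0.
  have [q00|q00] := eqVneq q 0.
    have := H 0; rewrite q00 expr0n !mulr0 !addr0 => ab.
    by apply/eqP; rewrite -sqrf_eq0 eq_le sqr_ge0 andbT; have := sqr_ge0 a; lra.
  (* This [t] makes the cross term [2 * b * t * q] equal to [2 * (c * q)^2], leaving
     [a^2 + b^2 + (c * q)^2 <= 0]. *)
  apply/eqP/negPn/negP => b0; have := H ((c * q) ^+ 2 / (b * q)).
  set t := _ / _; have tE : t * q * b = (c * q) ^+ 2 by rewrite /t; field; rewrite b0 q00.
  have b2 : 0 < b ^+ 2 by rewrite exprn_even_gt0.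
  have := sqr_ge0 a; have := sqr_ge0 (c * q); nra.
split => //; have := H 0; rewrite b0 mul0r add0r expr0n /= !addr0 -exprMn => acq.
have cq0 : 0 <= c * q by rewrite mulr_ge0.
rewrite leNgt; apply/negP => acq0; nra.
Qed.

Lemma Kcone_unit : Kcone u (const_mx u : 'M[V]_1).
Proof.
move=> k phi [_ _ phiu] xi; rewrite ampl_unit// mul1mx.
exact: (dnorm_ge0 (@cvdot R _)).
Qed.

(* For self-adjoint operators [||v + i t||^2 = ||v||^2 + t^2]; contractive unital
   maps see the self-adjointness of [v] through this bound. *)
Lemma Kcone_shift (v : V) :
  (forall t : R, vnorm (v + (0 +i* t) *: u) ^+ 2 <= vnorm v ^+ 2 + t ^+ 2) ->
  Kcone u (const_mx (v + (vnorm v)%:C *: u) : 'M[V]_1).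
Proof.
move=> Hv k phi phiS xi; have [_ _ phiu] := phiS.
have amplE w a : ampl phi (const_mx (w + a *: u) : 'M[V]_1) *m xi =
    ampl phi (const_mx w : 'M[V]_1) *m xi + a *: xi.
  rewrite -[X in _ = _ + a *: X]mul1mx -(ampl_unit phiu) scalemxAl -mulmxDl -amplZ -amplD.
  by congr (ampl _ _ *m _); apply/matrixP => i j; rewrite !mxE.
set z := cvdot (ampl phi (const_mx v : 'M[V]_1) *m xi) xi.
set q := l2norm xi ^+ 2.
have cvdotDZ a (x y : 'cV[C]_(\sum_(i < 1) k.+1)) :
    cvdot (x + a *: y) y = cvdot x y + a * (l2norm y ^+ 2)%:C.
  by rewrite (dotDl (@cvdot R _)) (dotZl (@cvdot R _)) -cvdotE.
(* The shifted element has quadratic form [z + vnorm v * q] at [xi]. *)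
suff [z0 zq] : complex.Im z = 0 /\ 0 <= complex.Re z + vnorm v * q.
  rewrite -[leRHS]/(cvdot _ _) amplE cvdotDZ.
  rewrite -/q -/z -rmorphM; move: z0 zq.
  case: (z) => a b /= -> abq.
  by rewrite complexr0 -rmorphD ler0c.
apply: numerical_range_bound; rewrite ?mxnorm_ge0 ?sqr_ge0// => t.
set A := ampl phi (const_mx (v + (0 +i* t) *: u) : 'M[V]_1).
have Axi : l2norm (A *m xi) ^+ 2 <= (vnorm v ^+ 2 + t ^+ 2) * q.
  apply: le_trans (ler_wpM2r (sqr_ge0 _) (Hv t)).
  rewrite -exprMn ler_pXn2r ?nnegrE ?mulr_ge0 ?l2norm_ge0 ?mxnorm_ge0//.
  by apply: mx_opnorm_bound; exact: mxstate_contractive phiS.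
(* Squared, and combined with [Axi], this is the bound on [|z + i t q|^2] required by
   [numerical_range_bound]. *)
have := dot_CauchySchwarz (@cvdot R _) (A *m xi) xi.
rewrite -(@ler_pXn2r _ 2)// ?nnegrE ?mulr_ge0 ?(sqrt_dnorm_ge0 (@cvdot R _))//.
rewrite exprMn !sqrtCK /= !cvdotE -/q -rmorphM amplE cvdotDZ -/z -/q.
rewrite normc_def -rmorphXn lecR sqr_sqrtr ?addr_ge0 ?sqr_ge0//.
rewrite -amplE -/A => H; apply: (@le_trans _ _ ((vnorm v ^+ 2 + t ^+ 2) * q * q)).
  apply: le_trans (ler_wpM2r (sqr_ge0 _) Axi); apply: le_trans H.
  by case: (z) => a b /=; rewrite !mul0r !mulr0 subrr addr0 add0r.
by rewrite -mulrA.
Qed.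

Section OperatorSystem.
Variables (K : hilbertType R) (Phi : {linear V -> (K -> K)}).
Hypothesis Phi_bounded : forall v, bounded_op (Phi v).
Hypothesis Phi_isometric : forall k (x : 'M[V]_k.+1),
  opnorm (op_app (map_mx Phi x)) = (mxnorm x)%:E.
Hypothesis Phi_unit : Phi u = idfun.
Hypothesis Phi_adjoint : forall v, exists w, adjoint_op (Phi v) (Phi w).
Local Notation dot := (hdot K).

Lemma gamma_isometric k (x : 'M[V]_k.+1) : mxnorm x = 1 -> gamma u x = 1%E.
Proof.
move=> x1; apply/eqP; rewrite eq_le; apply/andP; split.
  by rewrite -[in leRHS]x1 gamma_le_mxnorm.
rewrite leNgt; apply/negP => gam1.
(* Comparing also with 0 yields a vector with nonzero image, which excludes an empty orthonormal
   family: states have size at least 1. *)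
have : (maxe (gamma u x) 0 < opnorm (op_app (map_mx Phi x)))%E.
  by rewrite Phi_isometric x1 gt_max gam1 lte_fin ltr01.
move=> /ereal_sup_gt[_ [xi /= xi1 <-]]; rewrite gt_max => /andP[gam pos].
(* The span contains the components of [xi], so that the compression can be applied to it, and those
   of its image, so that no norm is lost. *)
have [n [e [onE espan]]] := gram_schmidt dot
  ([seq xi j 0 | j <- enum 'I_k.+1] ++
   [seq op_app (map_mx Phi x) xi i 0 | i <- enum 'I_k.+1]).
have ispan i : exists c : 'I_n -> C, op_app (map_mx Phi x) xi i 0 = \sum_a c a *: e a.
  by apply: espan; rewrite mem_cat; apply/orP; right; apply/mapP; exists i;
    rewrite ?mem_enum.
case: n => [|n] in e onE espan ispan *.
  move: pos; rewrite (_ : op_app _ _ = 0) ?l2norm0 ?ltxx//.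
  by apply/colP => i; have [c ->] := ispan i; rewrite big_ord0 mxE.
pose eta j := \col_a dot (xi j 0) (e a).
have xiE : \col_j lincomb e (eta j) = xi.
  apply/colP => j; rewrite mxE.
  have [c xc] : exists c : 'I_n.+1 -> C, xi j 0 = \sum_a c a *: e a.
    by apply: espan; rewrite mem_cat; apply/orP; left; apply/mapP; exists j;
      rewrite ?mem_enum.
  rewrite [RHS]xc; apply: eq_bigr => a _; rewrite mxE xc.
  by rewrite dot_lincombl.
have := compress_ampl_eq Phi_bounded onE (x := x) (eta := eta); rewrite xiE => /(_ ispan).
apply/eqP; rewrite lt_eqF// -lte_fin; apply: le_lt_trans gam.
apply: (@le_trans _ _ (mx_opnorm (ampl (compress Phi e) x))).
  by apply: le_opnorm; rewrite -(l2norm_lincomb onE) xiE.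
apply: ereal_sup_ubound; exists n.
by exists (compress Phi e) => //; apply: compress_state.
Qed.

Lemma ncb_isometric : ncb u = 1%E.
Proof.
apply/eqP; rewrite eq_le; apply/andP; split.
  (* The unit itself, of norm 1, shows that the infimum is over a nonempty set. *)
  apply: ereal_inf_lbound; exists 0, (const_mx u) => //.
  by rewrite gamma_isometric.
apply: le_ereal_inf_tmp => _ [k [x x1 ->]]; by rewrite gamma_isometric.
Qed.

(** Self-adjointness cancels the cross terms: ||(T + it)x||^2 = ||Tx||^2 + t^2 ||x||^2. *)
Lemma vnorm_shift v : adjoint_op (Phi v) (Phi v) ->
  forall t : R, vnorm (v + (0 +i* t) *: u) ^+ 2 <= vnorm v ^+ 2 + t ^+ 2.
Proof.
move=> vv t; set w := v + _.
have opE (w' : V) (xi : 'cV[K]_1) :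
    (l2norm (op_app (map_mx Phi (const_mx w' : 'M[V]_1)) xi) ^+ 2)%:C =
    dot (Phi w' (xi 0 0)) (Phi w' (xi 0 0)).
  by rewrite l2norm_sqr big_ord1 -hdotE op_appE big_ord1 mxE.
have c0 : 0 <= vnorm v ^+ 2 + t ^+ 2 by rewrite addr_ge0 ?sqr_ge0.
suff : vnorm w <= Num.sqrt (vnorm v ^+ 2 + t ^+ 2).
  by rewrite -(@ler_pXn2r _ 2) ?nnegrE ?sqrtr_ge0 ?mxnorm_ge0// sqr_sqrtr.
rewrite -lee_fin -Phi_isometric; apply: ge_ereal_sup => _ [xi /= xi1 <-].
rewrite lee_fin -(@ler_pXn2r _ 2) ?nnegrE ?sqrtr_ge0 ?l2norm_ge0//.
rewrite (sqr_sqrtr c0); set x := xi 0 0.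
have vx : l2norm (op_app (map_mx Phi (const_mx v : 'M[V]_1)) xi) <= vnorm v.
  by rewrite -lee_fin -Phi_isometric; exact: le_opnorm.
have x1 : l2norm xi ^+ 2 <= 1 by rewrite expr_le1 ?l2norm_ge0.
have xE : (l2norm xi ^+ 2)%:C = dot x x by rewrite l2norm_sqr big_ord1 -hdotE.
have wE : Phi w x = Phi v x + (0 +i* t) *: x by rewrite linearD linearZ Phi_unit.
have -> : l2norm (op_app (map_mx Phi (const_mx w : 'M[V]_1)) xi) ^+ 2 =
    l2norm (op_app (map_mx Phi (const_mx v : 'M[V]_1)) xi) ^+ 2 + t ^+ 2 * l2norm xi ^+ 2.
  apply: complexI; rewrite rmorphD [X in _ = _ + X]rmorphM.
  rewrite [X in _ = X + _]opE [X in _ = _ + _ * X]xE.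
  rewrite opE -/x wE.
  rewrite dotDl !dotDr !dotZl !dotZr (vv x x).
  have -> : (t*i)^*%R = - t*i :> C by rewrite /=; simpc.
  rewrite [X in _ = _ + X * _](_ : _ = - (t*i * t*i)) /=; last by simpc; rewrite expr2.
  ring.
apply: lerD; first by rewrite ler_pXn2r ?nnegrE ?l2norm_ge0 ?mxnorm_ge0.
by rewrite ler_piMr ?sqr_ge0.
Qed.

Lemma Kcone_spans : spans [set v : V | Kcone u (const_mx v : 'M[V]_1)].
Proof.
move=> v; have [w vw] := Phi_adjoint v.
have wv x y : dot (Phi w x) y = dot x (Phi v y) by rewrite dotC -vw -dotC.
(* Up to a factor 2, [h1] and [h2] are the real part and minus the imaginary part of [v], so that
   [v = (h1 - i h2) / 2]. *)
pose h1 := v + w; pose h2 := 'i *: (v - w).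
have PhiDE a b x : Phi (a + b) x = Phi a x + Phi b x by rewrite linearD.
have PhiBE a b x : Phi (a - b) x = Phi a x - Phi b x by rewrite linearB.
have PhiZE a b x : Phi (a *: b) x = a *: Phi b x by rewrite linearZ.
have h1s : adjoint_op (Phi h1) (Phi h1).
  by move=> x y; rewrite !PhiDE dotDl dotDr vw wv addrC.
have h2s : adjoint_op (Phi h2) (Phi h2).
  move=> x y; rewrite !PhiZE !PhiBE dotZl dotZr dotBl dotBr vw wv.
  rewrite (_ : 'i^*%R = - 'i); last by rewrite /=; simpc.
  by rewrite mulNr -mulrN opprB.
pose p1 := h1 + (vnorm h1)%:C *: u; pose p2 := h2 + (vnorm h2)%:C *: u.
(* The third coefficient cancels the multiples of [u] contained in [p1] and [p2]. *)
exists 3, (fun i => nth 0 [:: 2^-1; - 'i / 2; ('i * (vnorm h2)%:C - (vnorm h1)%:C) / 2] i),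
  (fun i => nth 0 [:: p1; p2; u] i); split.
  case=> -[|[|[|//]]] ?; rewrite /=.
  - exact/Kcone_shift/vnorm_shift.
  - exact/Kcone_shift/vnorm_shift.
  - exact: Kcone_unit.
rewrite !big_ord_recl big_ord0 /= addr0 /p1 /p2 !scalerDr /h1 /h2 !scalerA.
have -> : - 'i / 2 * 'i = 2^-1 :> C by rewrite mulrAC mulNr -expr2 sqr_i opprK mul1r.
rewrite -(addrA (_ *: (v - w))) -scalerDl addrACA -scalerDl scalerBr.
rewrite [X in X *: u](_ : _ = 0); last by field.
rewrite scale0r addr0 addrACA subrr addr0 -scalerDl.
by rewrite [X in X *: v](_ : _ = 1) ?scale1r//; field.
Qed.

End OperatorSystem.
End OrderUnit.

(** * The universal representation *)

Lemma bounded_linear_continuous (F : numFieldType) (W : normedModType F)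
    (f : W -> W) (c : F) : linear f -> 0 <= c -> (forall x, `|f x| <= c * `|x|) ->
  continuous f.
Proof.
move=> lin c0 fc x; apply/cvgrPdist_le => e e0.
(* The bound [c] may be 0, so the division is by [c + 1]. *)
have c1 : 0 < c + 1 by rewrite ltr_wpDl.
have /cvgrPdist_le/(_ (e / (c + 1))) : (id : W -> W) @ x --> x by exact: cvg_id.
rewrite divr_gt0// => /(_ isT); apply: filterS => y xy.
have -> : f x - f y = f (x - y).
  by have := lin (-1) y x; rewrite !scaleN1r addrC => <-; congr f; rewrite addrC.
apply: (le_trans (fc _)); rewrite ler_pdivlMr// in xy; apply: le_trans xy.
by rewrite mulrC ler_wpM2l// lerDl.
Qed.

Section SingleCoordinate.
Variables (R : realType) (S : choiceType) (d : S -> nat).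
Local Notation C := R[i].

(** The embedding of the summand at [s]. The type of [b] depends on [s], hence the transport along
    [s = t]; [eq_axiomK] removes it on the diagonal. *)
Definition single_fam s (b : 'cV[C]_(d s)) : cvfam R d := fun t =>
  if pselect (s = t) is left e then eq_rect s (fun t => 'cV[C]_(d t)) b t e else 0.

Lemma single_famE s (b : 'cV[C]_(d s)) : single_fam b s = b.
Proof.
by rewrite /single_fam; case: pselect => // e; rewrite (eq_axiomK e).
Qed.

Lemma single_fam_neq s (b : 'cV[C]_(d s)) t : t != s -> single_fam b t = 0.
Proof.
by rewrite /single_fam; case: pselect => // e /eqP; rewrite -{1}e.
Qed.

Fact single_sqsum s (b : 'cV[C]_(d s)) : single_fam b \in @sqsum_pred R S d.
Proof.
apply/asboolP; pose g := single_fam b.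
apply: (@ge0_absummable _ _ _ (l2norm b ^+ 2)) => [t|A]; first exact: sqr_ge0.
have gs0 t : t != s -> l2norm (single_fam b t) ^+ 2 = 0.
  by move=> ts; rewrite single_fam_neq// l2norm0 expr0n.
apply: (@le_trans _ _ (psum (fun t => l2norm (single_fam b t) ^+ 2) (s |` A)%fset)).
  by apply: psum_subset; [move=> t; exact: sqr_ge0 | exact: fsubsetU1].
rewrite /psum (big_fsetD1 s) ?fset1U1//= single_famE big1_seq ?addr0// => t.
by rewrite in_fsetD1 => /and3P[_ /gs0].
Qed.

Definition single s (b : 'cV[C]_(d s)) : hsum R d := Hsum (single_sqsum b).

Lemma hsumdot_single s (b : 'cV[C]_(d s)) (f : hsum R d) :
  hsumdot f (single b) = cvdot (f s) b.
Proof.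
rewrite /hsumdot (@csum_single _ _ _ s) /= ?single_famE// => t ts.
by rewrite single_fam_neq//; exact: (dot0r (@cvdot R _)).
Qed.

Lemma norm_single_sqr s (b : 'cV[C]_(d s)) : `|single b| ^+ 2 = cvdot b b.
Proof. by rewrite hsum_norm_sqr -hsumdotE hsumdot_single /= single_famE. Qed.

End SingleCoordinate.

Section Blocks.
Variables (R : realType) (V : matNormedType R) (n : nat).
Variable phi : {linear V -> 'M[R[i]]_n}.
Local Notation C := R[i].

(** The operator norm bound spelled out block by block, the form in which it can be summed over the
    direct sum. *)
Lemma block_bound k (x : 'M[V]_k) (c : R) (eta : 'I_k -> 'cV[C]_n) :
  0 <= c -> (mx_opnorm (ampl phi x) <= c%:E)%E ->
  \sum_i l2norm (\sum_j phi (x i j) *m eta j) ^+ 2 <= c ^+ 2 * \sum_j l2norm (eta j) ^+ 2.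
Proof.
move=> c0 /mx_opnorm_bound bnd.
have colE (zeta : 'I_k -> 'cV[C]_n) (p := fun _ : 'I_k => n) :
    \sum_i l2norm (zeta i) ^+ 2 = l2norm (\mxcol_(j < k) (zeta j : 'cV_(p j))) ^+ 2.
  apply: complexI; rewrite -cvdotE cvdot_mxcol rmorph_sum.
  by apply: eq_bigr => i _; rewrite cvdotE.
rewrite !colE -ampl_mxcol -exprMn ler_pXn2r ?nnegrE ?mulr_ge0 ?l2norm_ge0//.
Qed.

Lemma mx_pos_ampl k (x : 'M[V]_k) : mx_pos (ampl phi x) <->
  forall eta : 'I_k -> 'cV[C]_n,
    0 <= \sum_i cvdot (\sum_j phi (x i j) *m eta j) (eta i).
Proof.
split=> [pos eta|pos xi].
  rewrite -(cvdot_mxcol (fun i => \sum_j phi (x i j) *m eta j)) -ampl_mxcol.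
  exact: pos.
rewrite -[leRHS]/(cvdot _ _); have [eta ->] := mxcol_surj xi.
by rewrite ampl_mxcol cvdot_mxcol.
Qed.

End Blocks.

(** Polarization: the form is real at [a], [b], [a + b] and [a + 'i *: b]; the last two give the
    imaginary and the real part of the identity. *)
Lemma pos_mx_selfadjoint (R : realType) n (A : 'M[R[i]]_n) :
  (forall a, 0 <= cvdot (A *m a) a) ->
  forall a b, cvdot (A *m a) b = cvdot a (A *m b).
Proof.
move=> pos a b; rewrite (dotC (@cvdot R n) a).
have Im0 (z : R[i]) : 0 <= z -> complex.Im z = 0.
  by case: z => x y; rewrite lecE => /andP[/eqP].
have Ima := Im0 _ (pos a); have Imb := Im0 _ (pos b).
have := Im0 _ (pos (a + b)); have := Im0 _ (pos (a + 'i *: b)).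
rewrite !mulmxDr -!scalemxAr.
rewrite !(dotDl (@cvdot R n)) !(dotDr (@cvdot R n)).
rewrite !(dotZl (@cvdot R n)) !(dotZr (@cvdot R n)).
move: Ima Imb; rewrite /=.
case: (cvdot (A *m a) a) => ? ? /= ->; case: (cvdot (A *m b) b) => ? ? /= ->.
case: (cvdot (A *m a) b) => x y; case: (cvdot (A *m b) a) => z w /=.
move=> H1 H2; congr (_ +i* _); lra.
Qed.

(** * Block-diagonal operators on the direct sum *)

Section DiagonalOperators.
Variables (R : realType) (V : matNormedType R) (S : choiceType) (d : S -> nat).
Variable phi : forall s, {linear V -> 'M[R[i]]_(d s)}.
Hypothesis phi_contractive : forall s k (x : 'M[V]_k.+1),
  (mx_opnorm (ampl (phi s) x) <= (mxnorm x)%:E)%E.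
Local Notation C := R[i].
Local Notation K := (hsum_hilbert R d).

Lemma diag_bound v s (b : 'cV[C]_(d s)) :
  l2norm (phi s v *m b) ^+ 2 <= vnorm v ^+ 2 * l2norm b ^+ 2.
Proof.
have := block_bound (fun _ : 'I_1 => b) (mxnorm_ge0 _)
  (phi_contractive s (const_mx v : 'M[V]_1)).
by rewrite !big_ord1 mxE.
Qed.

(** The bound [vnorm v] on the blocks is uniform in [s]. *)
Fact diag_sqsum v (f : hsum R d) :
  (fun s => phi s v *m f s : 'cV_(d s)) \in @sqsum_pred R S d.
Proof.
apply/asboolP; apply: absummable_le (absummableZ (vnorm v ^+ 2) (hsum_absummable f)).
by move=> s; rewrite ger0_norm ?sqr_ge0 ?diag_bound.
Qed.

Definition diag (v : V) : K -> K := fun f => Hsum (diag_sqsum v f).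

Lemma diagE v (f : hsum R d) s : (diag v f : hsum R d) s = phi s v *m f s.
Proof. by []. Qed.

Fact diag_linear : linear diag.
Proof.
move=> a v w; apply/funext => f; apply: hsumP => s.
by rewrite diagE linearP mulmxDl -scalemxAl.
Qed.

HB.instance Definition _ :=
  GRing.isLinear.Build C V (K -> K) _ diag diag_linear.

Lemma diag_norm v (f : K) : `|diag v f| <= (vnorm v)%:C * `|f|.
Proof.
rewrite -(@ler_pXn2r _ 2) ?nnegrE ?mulr_ge0 ?ler0c ?mxnorm_ge0//.
rewrite exprMn !hsum_norm_sqr -rmorphXn -rmorphM lecR -rsumZ; last exact: hsum_absummable.
apply: le_rsum => [||s]; first exact: hsum_absummable.
  exact/absummableZ/hsum_absummable.
exact: diag_bound.
Qed.

Lemma diag_bounded v : bounded_op (diag v).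
Proof.
have lin : linear (diag v).
  by move=> a f g; apply: hsumP => s; rewrite diagE /= mulmxDr -scalemxAr.
split=> //; apply: (@bounded_linear_continuous _ K _ (vnorm v)%:C lin).
  by rewrite ler0c mxnorm_ge0.
exact: diag_norm.
Qed.

Lemma op_app_diag k (x : 'M[V]_k) (xi : 'cV[K]_k) i s :
  (op_app (map_mx diag x) xi i 0 : hsum R d) s =
  \sum_j phi s (x i j) *m (xi j 0 : hsum R d) s.
Proof.
rewrite mxE (big_morph (fun f : hsum R d => f s) (id1 := 0) (op1 := +%R)) //.
by apply: eq_bigr => j _; rewrite mxE diagE.
Qed.

Lemma l2norm_hsum k (xi : 'cV[K]_k) :
  absummable (fun s => \sum_j l2norm ((xi j 0 : hsum R d) s) ^+ 2) /\
  l2norm xi ^+ 2 = rsum (fun s => \sum_j l2norm ((xi j 0 : hsum R d) s) ^+ 2).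
Proof.
have [] := rsum_sum (enum 'I_k) (fun j => hsum_absummable (xi j 0)).
rewrite !big_enum; under eq_fun do rewrite big_enum.
move=> sums E; split=> //; rewrite E; apply: complexI.
by rewrite l2norm_sqr rmorph_sum; apply: eq_bigr => j _; exact: hsum_norm_sqr.
Qed.

Lemma diag_opnorm_le k (x : 'M[V]_k.+1) :
  (opnorm (op_app (map_mx diag x)) <= (mxnorm x)%:E)%E.
Proof.
apply: opnorm_le => [|xi]; first exact: mxnorm_ge0.
rewrite -(@ler_pXn2r _ 2) ?nnegrE ?mulr_ge0 ?l2norm_ge0 ?mxnorm_ge0// exprMn.
have [s1 ->] := l2norm_hsum (op_app (map_mx diag x) xi).
have [s2 ->] := l2norm_hsum xi.
rewrite -rsumZ//; apply: le_rsum => // [|s]; first exact: absummableZ.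
under eq_bigr do rewrite op_app_diag.
exact: block_bound (mxnorm_ge0 _) (phi_contractive s x).
Qed.

(** Test vectors of one block embed isometrically as vectors supported at [s], and coordinate [s] of
    the image recovers the block. *)
Lemma block_opnorm_le s k (x : 'M[V]_k) :
  (mx_opnorm (ampl (phi s) x) <= opnorm (op_app (map_mx diag x)))%E.
Proof.
apply: ge_ereal_sup => _ [xi /= xi1 <-]; have [eta xiE] := mxcol_surj xi.
pose sxi : 'cV[K]_k := \col_j (single (eta j) : K).
have sxi1 : l2norm sxi <= 1.
  rewrite (_ : l2norm _ = l2norm xi)//.
  apply/eqP; rewrite -(@eqrXn2 _ 2) ?l2norm_ge0//; apply/eqP/complexI.
  rewrite l2norm_sqr xiE -cvdotE cvdot_mxcol; apply: eq_bigr => j _.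
  by rewrite mxE; exact: norm_single_sqr.
apply: le_trans (le_opnorm _ sxi1); rewrite lee_fin.
rewrite -(@ler_pXn2r _ 2) ?nnegrE ?l2norm_ge0// -lecR.
rewrite xiE ampl_mxcol -cvdotE cvdot_mxcol l2norm_sqr; apply: ler_sum => i _.
rewrite [leRHS]hsum_norm_sqr -hsumdotE cvdotE.
have := l2norm_le_hsumdot (op_app (map_mx diag x) sxi i 0) s.
rewrite op_app_diag; under eq_bigr do rewrite mxE /= single_famE.
exact.
Qed.

Lemma diag_adjoint v : (forall s a, 0 <= cvdot (phi s v *m a) a) ->
  adjoint_op (diag v) (diag v).
Proof.
move=> pos f g; congr csum; apply/funext => s.
by rewrite !diagE; exact: pos_mx_selfadjoint.
Qed.

Lemma diag_quadratic k (x : 'M[V]_k) (xi : 'cV[K]_k) :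
  \sum_(i < k) hdot K (op_app (map_mx diag x) xi i 0) (xi i 0) =
  \sum_(i < k) hsumdot (op_app (map_mx diag x) xi i 0) (xi i 0).
Proof. by []. Qed.

(** Vectors supported at [s] test the block at [s]; conversely the quadratic form is the sum of the
    block forms. *)
Lemma diag_pos k (x : 'M[V]_k) :
  op_pos (map_mx diag x) <-> forall s, mx_pos (ampl (phi s) x).
Proof.
split=> [[_ pos] s|pos].
  apply/mx_pos_ampl => eta.
  have := pos (\col_j (single (eta j) : K)).
  rewrite diag_quadratic; congr (0 <= _); apply: eq_bigr => i _.
  rewrite [X in hsumdot _ X]mxE hsumdot_single op_app_diag; congr cvdot.
  by apply: eq_bigr => j _; rewrite mxE /= single_famE.
split=> [i j|xi]; first by rewrite mxE; exact: diag_bounded.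
rewrite diag_quadratic.
have [sums sumE] := csum_sum (enum 'I_k) (fun i =>
  hsumdot_csummable (op_app (map_mx diag x) xi i 0) (xi i 0)).
rewrite big_enum in sumE; rewrite -sumE; apply: csum_ge0 => // s.
rewrite big_enum; under eq_bigr do rewrite op_app_diag.
by move: (pos s) => /mx_pos_ampl.
Qed.

End DiagonalOperators.

(** * The representation indexed by all matrix states *)

Section UniversalRepresentation.
Variables (R : realType) (V : matNormedType R) (u : V).
Local Notation C := R[i].

(** The wrapper [{classic _}] supplies the choice structure required of the index type of [hsum]. *)
Definition state :=
  {classic {n & {phi : {linear V -> 'M[C]_n.+1} | mxstates u phi}}}.

Definition state_dim (s : state) : nat := (projT1 s).+1.

Definition state_map (s : state) : {linear V -> 'M[C]_(state_dim s)} :=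
  sval (projT2 s).

Lemma state_mapP s : mxstates u (state_map s).
Proof. exact: svalP (projT2 s). Qed.

Lemma state_map_contractive s k (x : 'M[V]_k.+1) :
  (mx_opnorm (ampl (state_map s) x) <= (mxnorm x)%:E)%E.
Proof. exact: mxstate_contractive (state_mapP s). Qed.

Local Notation Phi := (diag state_map_contractive).
Local Notation K := (hsum_hilbert R state_dim).

Lemma universal_unit : Phi u = idfun.
Proof.
apply/funext => f; apply: hsumP => s; rewrite diagE.
by have [_ _ ->] := state_mapP s; rewrite mul1mx.
Qed.

Lemma universal_isometric : ncb u = 1%E -> forall k (x : 'M[V]_k.+1),
  opnorm (op_app (map_mx Phi x)) = (mxnorm x)%:E.
Proof.
move=> ncb1 k x; apply/eqP; rewrite eq_le diag_opnorm_le /=.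
have [->|x0] := eqVneq x 0.
  rewrite mxnorm0; apply: le_trans (@le_opnorm _ _ _ _ _ _ 0 _).
    by rewrite lee_fin l2norm_ge0.
  by rewrite l2norm0.
have xp := mxnorm_gt0 x0; have y1 := mxnorm_normalize x0.
set y := map_mx _ _ in y1.
rewrite leNgt; apply/negP => lt_x.
have /fineK cE : opnorm (op_app (map_mx Phi x)) \is a fin_num.
  rewrite fin_numE; apply/andP; split; last by rewrite lt_eqF// (lt_trans lt_x) ?ltry.
  rewrite gt_eqF// (lt_le_trans (ltNyr 0))//.
  apply: le_trans (@le_opnorm _ _ _ _ _ _ 0 _); first by rewrite lee_fin l2norm_ge0.
  by rewrite l2norm0.
set c := fine _ in cE; rewrite -cE lte_fin in lt_x.
(* If [x] were represented with norm [c < mxnorm x], every state would have norm at most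
   [c / mxnorm x < 1] on the normalization [y], against index 1. *)
have : (gamma u y <= ((mxnorm x)^-1 * c)%:E)%E.
  apply: ge_ereal_sup => _ [n [phi phiS ->]].
  have sc : (mx_opnorm (ampl phi x) <= c%:E)%E.
    rewrite cE; exact: (block_opnorm_le state_map_contractive
      (existT _ n (exist _ phi phiS) : state)).
  have c0 : 0 <= c by rewrite -lee_fin (le_trans (mx_opnorm_ge0 _) sc).
  apply: opnorm_le => [|xi]; first by rewrite mulr_ge0// invr_ge0 ltW.
  rewrite amplZ -scalemxAl l2normZ Re_norm_real ?invr_ge0 ?(ltW xp)// -mulrA.
  by rewrite ler_wpM2l ?invr_ge0 ?(ltW xp)//; exact: mx_opnorm_bound.
apply/negP; rewrite -ltNge; apply: (@lt_le_trans _ _ 1%E).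
  by rewrite lte_fin ltr_pdivrMl// mulr1.
by rewrite -ncb1; apply: ereal_inf_lbound; exists k, y.
Qed.

Lemma Kcone_adjoint v : Kcone u (const_mx v : 'M[V]_1) -> adjoint_op (Phi v) (Phi v).
Proof.
move=> vK; apply: diag_adjoint => s a.
have /mx_pos_ampl/(_ (fun=> a)) := vK _ _ (state_mapP s).
by rewrite !big_ord1 mxE.
Qed.

Lemma universal_adjoint : spans [set v : V | Kcone u (const_mx v : 'M[V]_1)] ->
  forall v, exists w, adjoint_op (Phi v) (Phi w).
Proof.
move=> sp v; have [n [a [w [wK ->]]]] := sp v.
(* Cone elements act as self-adjoint operators, so conjugating the coefficients gives the
   adjoint. *)
exists (\sum_i (a i)^*%R *: w i) => f g.
rewrite !linear_sum !fct_sumE dot_suml dot_sumr; apply: eq_bigr => i _.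
have PhiZE b v' (h : K) : Phi (b *: v') h = b *: Phi v' h by rewrite linearZ.
rewrite /= !PhiZE dotZl dotZr conjCK; by rewrite (Kcone_adjoint (wK i)).
Qed.

Lemma Kcone_cone n : cone (@Kcone _ _ u n.+1).
Proof.
have posE k (phi : {linear V -> 'M[C]_k.+1}) (x : 'M[V]_n.+1) :
  mx_pos (ampl phi x) <->
  forall xi, 0 <= cvdot (ampl phi x *m xi) xi by [].
split=> [k phi _|x y xK yK k phi phiS|t x t0 xK k phi phiS]; apply/posE => xi.
- have -> : ampl phi (0 : 'M[V]_n.+1) = 0.
    by apply/matrixP => i j; rewrite !mxE linear0 mxE.
  by rewrite mul0mx (dot0l (@cvdot R _)).
- rewrite amplD mulmxDl (dotDl (@cvdot R _)).
  by apply: addr_ge0; [exact: xK | exact: yK].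
- rewrite amplZ -scalemxAl (dotZl (@cvdot R _)).
  by apply: mulr_ge0; [rewrite ler0c | exact: xK].
Qed.

Lemma Kcone_image n :
  map_mx Phi @` @Kcone _ _ u n.+1 =
  range (fun x : 'M[V]_n.+1 => map_mx Phi x) `&` @op_pos R K n.+1.
Proof.
apply/seteqP; split=> [_ [x xK <-]|_ [[x _ <-] pos]].
  split; first by exists x.
  by apply/diag_pos => s; apply: xK; exact: state_mapP.
exists x => // k phi phiS.
by have /diag_pos/(_ (existT _ k (exist _ phi phiS) : state)) := pos.
Qed.

Lemma universal_operator_system : ncb u = 1%E ->
  spans [set v : V | Kcone u (const_mx v : 'M[V]_1)] ->
  operator_system (MatrixOrder Kcone_cone) u.
Proof.
move=> ncb1 sp; exists K, Phi; split.
- exact: diag_bounded.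
- exact: universal_isometric.
- exact: universal_adjoint.
- exact: universal_unit.
- exact: Kcone_image.
Qed.

End UniversalRepresentation.

Theorem theorem3p2 (R : realType) (V : matNormedType R) (u : V)
    (hu : vnorm u = 1%R) :
  (exists C : matrix_order V, operator_system C u) <->
  (ncb u = 1%E /\ spans [set v : V | Kcone u (const_mx v : 'M[V]_1)]%classic).
Proof.
split=> [[C [K [Phi [bnd iso adj unit _]]]]|[ncb1 sp]]; last first.
  (* The order structure on [V] is the one given by the cones [Kcone u]. *)
  by exists (MatrixOrder (Kcone_cone u)); exact: universal_operator_system.
by split; [exact: (ncb_isometric hu bnd iso unit) | exact: (Kcone_spans iso unit adj)].
Qed.
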